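(* Let $0<|q|<1$ and let $U=U_x\cup U_y\subseteq\mathbb{C}_{xy}$ be $(\mathfrak{q},\mathfrak{d})$-open, $U_y=B(0,r_y)$. Then $$\mathcal{O}_q(U)=\mathcal{O}(U_x)\oplus\operatorname{Rad}\mathcal{O}_q(U)\oplus\mathcal{I}_{\mathfrak{d}}(U_y)$$ is a topological direct sum of closed subalgebras, where $\mathcal{O}(U_x)$ is embedded as the series $f_0(x)$ (i.e. $f_n=0$ for $n\ge1$), $\mathcal{I}_{\mathfrak{d}}(U_y)$ is the set of series $\sum_{n\ge1}a_ny^n$ with constants $a_n\in\mathbb{C}$, and $\operatorname{Rad}\mathcal{O}_q(U)=\{\sum_{n\ge1}f_n(x)y^n\in\mathcal{O}_q(U):f_n(0)=0\ \forall n\}$. In particular $\mathcal{O}_q(U)$ is commutative modulo its Jacobson radical, and $\lambda\mapsto(\lambda(x),\lambda(y))$ is a bijection from $\operatorname{Spec}(\mathcal{O}_q(U))$ onto $U=(U_x\times\{0\})\cup(\{0\}\times U_y)$.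
   Context: $q$-open: standard-open subset of $\mathbb{C}$ containing $0$ and $q^nz$ for each of its points $z$, $n\in\mathbb{Z}_+$. $\mathbb{C}_{xy}=(\mathbb{C}\times\{0\})\cup(\{0\}\times\mathbb{C})$. A $(\mathfrak{q},\mathfrak{d})$-open set is $U=U_x\cup U_y$ with $U_x\subseteq\mathbb{C}\times\{0\}\cong\mathbb{C}$ nonempty $q$-open and $U_y=B(0,r_y)\subseteq\{0\}\times\mathbb{C}$, $0<r_y\le\infty$. $\mathcal{O}_q(U)$ is the Fréchet algebra of formal series $f=\sum_{n\ge0}f_n(x)y^n$, $f_n\in\mathcal{O}(U_x)$, with $p_{K,\rho}(f)=\sum_n\|f_n\|_K\rho^n<\infty$ for all compact $K\subseteq U_x$ and $0<\rho<r_y$ ($\|g\|_K=\sup_K|g|$), topologized by these seminorms, with product $f\cdot g=\sum_n\big(\sum_{i+j=n}f_i(z)g_j(q^iz)\big)y^n$; equivalently $\mathcal{O}_q(U)\cong\mathcal{O}(U_x)\widehat{\otimes}\mathcal{O}(B(0,r_y))$ as Fréchet spaces. $\operatorname{Spec}$ is the set of continuous characters; $\operatorname{Rad}$ the Jacobson radical. *)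

(* Defs.v *)
From HB Require Import structures.
From mathcomp Require Import all_boot all_order all_algebra.
From mathcomp Require Import all_classical all_reals all_analysis.
From mathcomp Require Import complex.
Import Order.TTheory GRing.Theory Num.Theory.
Import numFieldNormedType.Exports.

Set Implicit Arguments.
Unset Strict Implicit.
Unset Printing Implicit Defensive.

Local Open Scope classical_set_scope.
Local Open Scope ring_scope.

Notation Cplx R := ((R[i])^o).

Definition cabs (R : realType) (z : Cplx R) : R :=
  Num.sqrt ((complex.Re (z : R[i])) ^+ 2 + (complex.Im (z : R[i])) ^+ 2).

(* Holomorphy on an open set: complex differentiability at every point
   (derivative along the direction 1 over the scalar field C). *)
Definition holomorphic_on (R : realType) (U : set (Cplx R)) (g : Cplx R -> Cplx R) :=
  forall z, U z -> derivable g z 1.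

Definition q_open (R : realType) (q : Cplx R) (Ux : set (Cplx R)) :=
  [/\ open Ux, Ux 0 & forall z n, Ux z -> (0 < n)%N -> Ux (q ^+ n * z)].

(* (q,d)-open set U = Ux u Uy with Uy = B(0, ry), 0 < ry <= +oo. *)
Definition qd_open (R : realType) (q : Cplx R) (Ux : set (Cplx R)) (ry : \bar R) :=
  q_open q Ux /\ (0 < ry)%E.

Definition disc (R : realType) (ry : \bar R) : set (Cplx R) :=
  [set w | ((cabs w)%:E < ry)%E].

Definition Ucxy (R : realType) (Ux : set (Cplx R)) (ry : \bar R) : set (Cplx R * Cplx R) :=
  [set ab | (Ux ab.1 /\ ab.2 = 0) \/ (ab.1 = 0 /\ disc ry ab.2)].

(* Formal series sum_n f_n(x) y^n are encoded by their coefficient sequence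
   f : nat -> C -> C; coefficients are functions on U_x, normalised to be 0
   outside U_x (so that equality of series is Leibniz equality). *)
Definition qseries (R : realType) := nat -> Cplx R -> Cplx R.

(* sup norm ||g||_K (with the convention ||g||_emptyset = 0). *)
Definition supnorm (R : realType) (K : set (Cplx R)) (g : Cplx R -> Cplx R) : \bar R :=
  ereal_sup ([set 0%E] `|` [set (cabs (g z))%:E | z in K]).

Definition pKr (R : realType) (K : set (Cplx R)) (rho : R) (f : qseries R) : \bar R :=
  (\sum_(0 <= n <oo) (supnorm K (f n) * (rho ^+ n)%:E))%E.

Definition adm (R : realType) (Ux : set (Cplx R)) (ry : \bar R) (K : set (Cplx R)) (rho : R) :=
  [/\ compact K, K `<=` Ux, 0 < rho & (rho%:E < ry)%E].

Definition Oq (R : realType) (Ux : set (Cplx R)) (ry : \bar R) (f : qseries R) :=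
  [/\ forall n, holomorphic_on Ux (f n),
      forall n z, ~ Ux z -> f n z = 0
    & forall K rho, adm Ux ry K rho -> (pKr K rho f < +oo)%E].

Definition sadd (R : realType) (f g : qseries R) : qseries R := fun n z => f n z + g n z.
Definition sopp (R : realType) (f : qseries R) : qseries R := fun n z => - f n z.
Definition ssub (R : realType) (f g : qseries R) : qseries R := fun n z => f n z - g n z.
Definition sscale (R : realType) (c : Cplx R) (f : qseries R) : qseries R := fun n z => c * f n z.
Definition szero (R : realType) : qseries R := fun _ _ => 0.

Definition smul (R : realType) (q : Cplx R) (Ux : set (Cplx R)) (f g : qseries R) : qseries R :=
  fun n z => if z \in Ux then \sum_(i < n.+1) f i z * g (n - i)%N (q ^+ i * z) else 0.

Definition sone (R : realType) (Ux : set (Cplx R)) : qseries R :=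
  fun n z => if (n == 0)%N && (z \in Ux) then 1 else 0.
Definition sx (R : realType) (Ux : set (Cplx R)) : qseries R :=
  fun n z => if (n == 0)%N && (z \in Ux) then z else 0.
Definition sy (R : realType) (Ux : set (Cplx R)) : qseries R :=
  fun n z => if (n == 1)%N && (z \in Ux) then 1 else 0.

Definition basic_nbhd (R : realType) (Ux : set (Cplx R)) (ry : \bar R) (f : qseries R)
    (m : nat) (Ks : nat -> set (Cplx R)) (rhos : nat -> R) (delta : R) : set (qseries R) :=
  [set g | forall i, (i < m)%N -> (pKr (Ks i) (rhos i) (ssub g f) < delta%:E)%E].

Definition nbhd_data (R : realType) (Ux : set (Cplx R)) (ry : \bar R)
    (m : nat) (Ks : nat -> set (Cplx R)) (rhos : nat -> R) (delta : R) :=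
  (forall i, (i < m)%N -> adm Ux ry (Ks i) (rhos i)) /\ 0 < delta.

Definition Oq_closed (R : realType) (Ux : set (Cplx R)) (ry : \bar R) (S : set (qseries R)) :=
  S `<=` Oq Ux ry /\
  forall f, Oq Ux ry f -> ~ S f ->
    exists m Ks rhos delta, nbhd_data Ux ry m Ks rhos delta /\
      forall g, Oq Ux ry g -> basic_nbhd Ux ry f m Ks rhos delta g -> ~ S g.

Definition Oq_continuous (R : realType) (Ux : set (Cplx R)) (ry : \bar R) (P : qseries R -> qseries R) :=
  forall f, Oq Ux ry f -> forall K rho eps, adm Ux ry K rho -> 0 < eps ->
    exists m Ks rhos delta, nbhd_data Ux ry m Ks rhos delta /\
      forall g, Oq Ux ry g -> basic_nbhd Ux ry f m Ks rhos delta g ->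
        (pKr K rho (ssub (P g) (P f)) < eps%:E)%E.

Definition Oq_continuous_fun (R : realType) (Ux : set (Cplx R)) (ry : \bar R) (l : qseries R -> Cplx R) :=
  forall f, Oq Ux ry f -> forall eps, 0 < eps ->
    exists m Ks rhos delta, nbhd_data Ux ry m Ks rhos delta /\
      forall g, Oq Ux ry g -> basic_nbhd Ux ry f m Ks rhos delta g ->
        cabs (l g - l f) < eps.

Definition subalgebra (R : realType) (q : Cplx R) (Ux : set (Cplx R)) (ry : \bar R) (S : set (qseries R)) :=
  [/\ S `<=` Oq Ux ry, S (@szero R),
      forall f g, S f -> S g -> S (sadd f g),
      forall c f, S f -> S (sscale c f)
    & forall f g, S f -> S g -> S (smul q Ux f g)].

Definition left_ideal (R : realType) (q : Cplx R) (Ux : set (Cplx R)) (ry : \bar R) (L : set (qseries R)) :=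
  [/\ L `<=` Oq Ux ry, L (@szero R),
      forall a b, L a -> L b -> L (sadd a b)
    & forall r a, Oq Ux ry r -> L a -> L (smul q Ux r a)].

Definition maximal_left_ideal (R : realType) (q : Cplx R) (Ux : set (Cplx R)) (ry : \bar R)
    (L : set (qseries R)) :=
  [/\ left_ideal q Ux ry L, ~ L (sone Ux)
    & forall L', left_ideal q Ux ry L' -> L `<=` L' -> ~ L' (sone Ux) -> L' `<=` L].

Definition jacobson_rad (R : realType) (q : Cplx R) (Ux : set (Cplx R)) (ry : \bar R) : set (qseries R) :=
  [set a | Oq Ux ry a /\ forall L, maximal_left_ideal q Ux ry L -> L a].

Definition character (R : realType) (q : Cplx R) (Ux : set (Cplx R)) (ry : \bar R) (l : qseries R -> Cplx R) :=
  [/\ forall f g, Oq Ux ry f -> Oq Ux ry g -> l (sadd f g) = l f + l g,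
      forall c f, Oq Ux ry f -> l (sscale c f) = c * l f,
      forall f g, Oq Ux ry f -> Oq Ux ry g -> l (smul q Ux f g) = l f * l g
    & exists f, Oq Ux ry f /\ l f <> 0].

Definition in_Spec (R : realType) (q : Cplx R) (Ux : set (Cplx R)) (ry : \bar R) (l : qseries R -> Cplx R) :=
  character q Ux ry l /\ Oq_continuous_fun Ux ry l.

Definition OUx_part (R : realType) (Ux : set (Cplx R)) (ry : \bar R) : set (qseries R) :=
  [set f | Oq Ux ry f /\ forall n, (0 < n)%N -> f n = (fun _ => 0)].

Definition Id_part (R : realType) (Ux : set (Cplx R)) (ry : \bar R) : set (qseries R) :=
  [set f | Oq Ux ry f /\ f 0%N = (fun _ => 0) /\
           forall n, (0 < n)%N -> exists a : Cplx R, forall z, Ux z -> f n z = a].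

Definition rad_part (R : realType) (Ux : set (Cplx R)) (ry : \bar R) : set (qseries R) :=
  [set f | Oq Ux ry f /\ f 0%N = (fun _ => 0) /\ forall n, f n 0 = 0].

(* Main.v *)
Require Import Defs.
From HB Require Import structures.
From mathcomp Require Import all_boot all_order all_algebra.
From mathcomp Require Import all_classical all_reals all_analysis.
From mathcomp Require Import complex.
From mathcomp Require Import ring lra zify.
Import Order.TTheory GRing.Theory Num.Theory.
Import numFieldNormedType.Exports.
Local Open Scope classical_set_scope.
Local Open Scope ring_scope.

(** The characters of O_q(U) are the evaluations f |-> f_0(a), a in U_x, and
    f |-> sum_n f_n(0) b^n, |b| < r_y; since yx = q xy with q <> 1, no character can be
    nonzero on both x and y. Their common kernel is the set of series with f_0 = 0 and
    f_n(0) = 0 for all n, and it contains the radical because kernels of characters are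
    maximal left ideals. Conversely, for h in this set the coefficients of
    u = 1 + h + h^2 + ... satisfy u_n(z) = sum_(i < n) u_i(z) h_(n-i)(q^i z). As q^i z -> 0
    and h_m(0) = 0, dominated convergence makes the sums over m of
    sup_K |h_m(q^i .)| rho^m tend to 0 with i, so from some i on they contract and
    sum_n sup_K |u_n| rho^n is finite: 1 - h is left invertible.
    Only continuity and the stability properties of complex differentiability are used,
    no Cauchy theory. *)

(** * Modulus, compact sets and holomorphic functions *)

Section ComplexModulus.
Variable R : realType.
Implicit Types (z w : Cplx R) (r : R).

(** The product evaluates the coefficients of its right factor at [q^i z], off [K]. Seminorms of
    products are therefore bounded through a larger compact set containing all [q^n K], and
    iterating that bound controls the powers of [h] only by powers of a seminorm of [h], which may
    exceed 1. Smallness has to come from the dilation. The recursion u = 1 + u h, rather than u = 1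
    + h u, puts every power of [q] on the arguments of [h] and evaluates [u] only on [K], so the
    estimate closes on one compact set. It also yields the one-sided inverse that maximal left
    ideals call for. A decay rate for sup |h_m(q^i .)| with constants summable in [m] would come
    from the Schwarz lemma or Cauchy estimates. Continuity at [0] gives a limit for each [m]
    separately, without a rate; domination by the seminorm over the larger compact set makes this
    enough. [U_x] need not be connected, so no identity theorem can transport information from [0]:
    the conditions h_n(0) = 0 act only through orbits tending to [0]. *)

Lemma cabsE z : (cabs z)%:C%C = `|z|.
Proof. by case: z. Qed.

Lemma cabs_ge0 z : 0 <= cabs z.
Proof. by rewrite sqrtr_ge0. Qed.

Lemma real_complexI (r s : R) : r%:C%C = s%:C%C -> r = s.
Proof. by case. Qed.

Lemma cabs0 : cabs (0 : Cplx R) = 0.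
Proof. by apply: real_complexI; rewrite cabsE normr0. Qed.

Lemma cabs1 : cabs (1 : Cplx R) = 1.
Proof. by apply: real_complexI; rewrite cabsE normr1. Qed.

Lemma cabsM z w : cabs (z * w) = cabs z * cabs w.
Proof. by apply: real_complexI; rewrite cabsE normrM rmorphM /= !cabsE. Qed.

Lemma cabsN z : cabs (- z) = cabs z.
Proof. by apply: real_complexI; rewrite !cabsE normrN. Qed.

Lemma cabsB z w : cabs (z - w) = cabs (w - z).
Proof. by rewrite -cabsN opprB. Qed.

Lemma cabsX z n : cabs (z ^+ n) = cabs z ^+ n.
Proof. by elim: n => [|n IH]; rewrite ?expr0 ?cabs1// !exprS cabsM IH. Qed.

Lemma cabs_eq0 z : cabs z = 0 -> z = 0.
Proof. by move=> h; apply/eqP; rewrite -normr_eq0 -cabsE h. Qed.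

Lemma cabs_gt0 z : z != 0 -> 0 < cabs z.
Proof.
move=> z0; rewrite lt_def cabs_ge0 andbT.
by apply/eqP => /cabs_eq0 h; rewrite h eqxx in z0.
Qed.

Lemma cabsV z : cabs z^-1 = (cabs z)^-1.
Proof.
have [->|z0] := eqVneq z 0; first by rewrite invr0 cabs0 invr0.
have c0 : cabs z != 0 by rewrite gt_eqF// cabs_gt0.
by apply: (mulfI c0); rewrite -cabsM !divff// cabs1.
Qed.

Lemma le_cabsD z w : cabs (z + w) <= cabs z + cabs w.
Proof. by rewrite -lecR rmorphD /= !cabsE ler_normD. Qed.

Lemma le_cabsBl z w : cabs z - cabs w <= cabs (z - w).
Proof. by rewrite lerBlDr (le_trans _ (le_cabsD _ _))// subrK. Qed.

Lemma cabs_real r : cabs (r%:C%C : Cplx R) = `|r|.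
Proof. by rewrite /cabs /= expr0n addr0 sqrtr_sqr. Qed.

Lemma cabs_sum n (F : 'I_n -> Cplx R) :
  cabs (\sum_(i < n) F i) <= \sum_(i < n) cabs (F i).
Proof.
elim: n F => [|n IH] F; first by rewrite !big_ord0 cabs0.
by rewrite !big_ord_recr /= (le_trans (le_cabsD _ _))// lerD2r.
Qed.

Lemma nbhs_cabsP z (A : set (Cplx R)) :
  nbhs z A <-> exists2 d : R, 0 < d & forall w, cabs (w - z) < d -> A w.
Proof.
split.
  move=> /nbhs_ballP[e /= e0 eA].
  (* Balls have radii in [R[i]], but a positive element of [R[i]] has zero imaginary part, so the
     radius is real. *)
  have re : e = (complex.Re e)%:C%C.
    case: e e0 {eA} => a b /=; rewrite ltcE /= => /andP[/eqP b0 _].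
    by apply/eqP; rewrite eq_complex /= b0 !eqxx.
  exists (complex.Re e); first by rewrite -ltcR -re.
  move=> w wz; apply: eA; rewrite -ball_normE /ball_ /=.
  by rewrite distrC -cabsE re ltcR.
move=> [d d0 dA]; apply/nbhs_ballP; exists (d%:C)%C; first by rewrite /= ltcR.
move=> w; rewrite -ball_normE /ball_ /= distrC -cabsE ltcR; exact: dA.
Qed.

Lemma continuous_cabsP (f : Cplx R -> Cplx R) z : {for z, continuous f} ->
  forall e : R, 0 < e -> exists2 d : R, 0 < d &
    forall w, cabs (w - z) < d -> cabs (f w - f z) < e.
Proof.
move=> fz e e0; apply/nbhs_cabsP.
have /fz : nbhs (f z) [set w | cabs (w - f z) < e] by apply/nbhs_cabsP; exists e.
done.
Qed.

(** Near covering with the filter at infinity on [nat]: around each point |z| <= n for all large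
    [n], hence on all of [K] for all large [n]. *)
Lemma compact_cabs_bounded (K : set (Cplx R)) : compact K ->
  exists2 M : R, 0 <= M & forall z, K z -> cabs z <= M.
Proof.
rewrite compact_near_coveringP.
move=> /(_ nat \oo (fun n z => cabs z <= n%:R) _)[x _|N _ KN]; last first.
  by exists N%:R; [exact: ler0n|move=> z /KN; apply => /=].
have [N xN] : exists N, cabs x + 1 <= N%:R.
  exists (Num.bound (cabs x + 1)).
  by apply/ltW/archi_boundP; rewrite addr_ge0// cabs_ge0.
exists ([set z | cabs (z - x) < 1], [set n | (N <= n)%N]) => /=.
  split; last by exists N.
  by apply/nbhs_cabsP; exists 1.
move=> [z n] /= [zx Nn]; have := le_cabsBl z x.
by move: Nn; rewrite -(ler_nat R); lra.
Qed.

Lemma geometric_small (a e : R) : 0 <= a -> a < 1 -> 0 < e ->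
  exists N, forall n, (N <= n)%N -> a ^+ n < e.
Proof.
move=> a0 a1 e0.
have /cvgrPdist_lt/(_ _ e0)[N _ aN] : a ^+ n @[n --> \oo] --> 0.
  by apply: cvg_expr; rewrite ger0_norm.
exists N => n /aN; rewrite /= sub0r normrN ger0_norm//; exact: exprn_ge0.
Qed.

(** A neighbourhood of [0] contains all but finitely many powers, and the remaining ones need only a
    finite intersection of members of the filter. *)
Lemma compact_powers (q : Cplx R) : cabs q < 1 ->
  compact ([set 0] `|` range (fun n => q ^+ n)).
Proof.
move=> q1; rewrite compact_near_coveringP => J F P FF cP.
have [[A G] /= [/nbhs_cabsP[d d0 dA] FG] AG] := cP 0 (or_introl erefl).
have [N qN] := geometric_small (cabs q) d (cabs_ge0 q) q1 d0.
have A0 : A 0 by apply: dA; rewrite subrr cabs0.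
have FN : F [set i | forall n, (n < N)%N -> P i (q ^+ n)].
  elim: (N) => [|m IH]; first by apply: filterE => i n.
  have [[B H] /= [Bm FH] BH] := cP (q ^+ m) (or_intror (ex_intro2 _ _ m Logic.I erefl)).
  apply: filterS2 IH FH => i /= im Hi n; rewrite ltnS leq_eqVlt => /orP[/eqP ->|/im//].
  exact: (BH (q ^+ m, i) (conj (nbhs_singleton Bm) Hi)).
apply: filterS2 FG FN => i Gi iN /= z [->|[n _ <-]].
  exact: (AG (0, i)).
have [/iN//|Nn] := ltnP n N.
by apply: (AG (q ^+ n, i)); split => //; apply: dA; rewrite subr0 cabsX qN.
Qed.

(** Written as an image under multiplication so that compactness is inherited from a product. The
    factor [0] closes the set of powers of [q]. *)
Definition orbit_hull (q : Cplx R) (K : set (Cplx R)) : set (Cplx R) :=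
  [set z.1 * z.2 | z in K `*` ([set 0] `|` range (fun n => q ^+ n))].

Lemma compact_orbit_hull (q : Cplx R) (K : set (Cplx R)) :
  cabs q < 1 -> compact K -> compact (orbit_hull q K).
Proof.
move=> q1 cK; apply: continuous_compact.
  by apply: continuous_subspaceT; exact: mul_continuous.
by apply: compact_setX => //; exact: compact_powers.
Qed.

Lemma orbit_hullM (q : Cplx R) (K : set (Cplx R)) n z :
  K z -> orbit_hull q K (q ^+ n * z).
Proof.
move=> Kz; exists (z, q ^+ n); last by rewrite mulrC.
by split => //; right; exists n.
Qed.

End ComplexModulus.
Arguments orbit_hull {R} q K.

(** Division by [0] returns [0], so the function takes the value [0] at [a]; its difference quotient
    there is the square of that of [f] and tends to f'(a)^2. *)
Lemma derivable_sqr_quotient (K : numFieldType) (f : K -> K) (a : K) :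
  derivable f a 1 -> derivable (fun z => (f z - f a) ^+ 2 / (z - a)) a 1.
Proof.
move=> /cvg_ex[l /= fl]; apply/cvg_ex; exists (l * l) => /=.
refine (cvg_trans _ (cvgM fl fl)); apply: near_eq_cvg; near=> h.
have h0 : h != 0 by near: h; exact: nbhs_dnbhs_neq.
rewrite /= [f a - f a]subrr expr0n mul0r subr0 [h%:A]mulr1 addrK /GRing.scale /=.
by field.
Unshelve. all: by end_near. Qed.

Section Holomorphic.
Variable R : realType.
Implicit Types (z a : Cplx R) (U : set (Cplx R)) (f g : Cplx R -> Cplx R).

Lemma eq_holomorphic U f g : open U -> (forall z, U z -> f z = g z) ->
  holomorphic_on U f -> holomorphic_on U g.
Proof.
move=> oU fg hf z Uz; apply: near_eq_derivable (hf z Uz).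
by apply: filterS (open_nbhs_nbhs (conj oU Uz)) => w /fg.
Qed.

Lemma holomorphic_cst U (c : Cplx R) : holomorphic_on U (fun _ => c).
Proof. by move=> z _; exact: derivable_cst. Qed.

Lemma holomorphic_id U : holomorphic_on U (fun z => z).
Proof. by move=> z _; exact: derivable_id. Qed.

Lemma holomorphicD U f g : holomorphic_on U f -> holomorphic_on U g ->
  holomorphic_on U (fun z => f z + g z).
Proof. by move=> hf hg z Uz; apply: derivableD; [exact: hf|exact: hg]. Qed.

Lemma holomorphicM U f g : holomorphic_on U f -> holomorphic_on U g ->
  holomorphic_on U (fun z => f z * g z).
Proof.
by move=> hf hg z Uz; apply: (@derivableM R[i] (Cplx R)); [exact: hf|exact: hg].
Qed.

Lemma holomorphicV U f : holomorphic_on U f -> (forall z, U z -> f z != 0) ->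
  holomorphic_on U (fun z => (f z)^-1).
Proof.
move=> hf f0 z Uz.
by apply: (@derivableV R[i] (Cplx R)); [exact: f0|exact: hf].
Qed.

Lemma holomorphic_sum U n (F : nat -> Cplx R -> Cplx R) :
  (forall i, (i < n)%N -> holomorphic_on U (F i)) ->
  holomorphic_on U (fun z => \sum_(i < n) F i z).
Proof.
elim: n => [|n IH] hF.
  under eq_fun do rewrite big_ord0; exact: holomorphic_cst.
under eq_fun do rewrite big_ord_recr /=.
apply: holomorphicD; last exact: hF.
by apply: IH => i ni; apply: hF; exact: ltnW.
Qed.

Lemma derivable_scale f (c : Cplx R) z :
  derivable f (c * z) 1 -> derivable (fun w => f (c * w)) z 1.
Proof.
move=> df; apply/derivable1_diffP.
apply: (@differentiable_comp _ _ _ _ (fun w : Cplx R => c * w) f z).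
  apply/derivable1_diffP.
  by apply: (@derivableM R[i] (Cplx R)); [exact: derivable_cst|exact: derivable_id].
exact/derivable1_diffP.
Qed.

Lemma holomorphic_continuous U f z : holomorphic_on U f -> U z -> {for z, continuous f}.
Proof.
move=> hf Uz; apply: differentiable_continuous.
by apply/derivable1_diffP; exact: hf.
Qed.

Lemma holomorphic_bounded U f (K : set (Cplx R)) : holomorphic_on U f ->
  compact K -> K `<=` U ->
  exists2 M : R, 0 <= M & forall z, K z -> cabs (f z) <= M.
Proof.
move=> hf cK KU; have [|M M0 fM] := @compact_cabs_bounded R [set f z | z in K].
  apply: continuous_compact => //.
  apply: (@continuous_in_subspaceT (Cplx R) (Cplx R) K f) => z.
  rewrite inE => /KU; exact: holomorphic_continuous.
by exists M => // z Kz; apply: fM; exists z.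
Qed.

Lemma holomorphic_sqr_quotient U f a : open U -> holomorphic_on U f ->
  holomorphic_on U (fun z => (f z - f a) ^+ 2 / (z - a)).
Proof.
move=> oU hf z Uz.
have hd (w : Cplx R) : derivable (fun z => z - a : Cplx R) w 1.
  by apply: (@derivableB R[i] (Cplx R)); [exact: derivable_id|exact: derivable_cst].
have [za|za] := eqVneq z a; last first.
  apply: (@derivableM R[i] (Cplx R)).
    by apply: (@derivableM R[i] (Cplx R)); apply: derivableB (hf z Uz) (derivable_cst _ _ _).
  apply: (@derivableV R[i] (Cplx R)); first by rewrite subr_eq0.
  exact: hd.
by subst z; apply: (@derivable_sqr_quotient R[i]); exact: hf.
Qed.

End Holomorphic.

(** * Series *)

(** Both sides run over the pairs with i + j < N. *)
Lemma sum_triangle (V : nmodType) (E : nat -> nat -> V) N :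
  \sum_(n < N) \sum_(i < n.+1) E i (n - i)%N = \sum_(i < N) \sum_(j < N - i) E i j.
Proof.
elim: N => [|N IH]; first by rewrite !big_ord0.
rewrite big_ord_recr /= IH big_ord_recr /= [RHS]big_ord_recr /=.
rewrite subSn// subnn big_ord_recr big_ord0 /= add0r addrA; congr +%R.
rewrite -big_split /=; apply: eq_bigr => i _.
by rewrite subSn 1?ltnW// big_ord_recr.
Qed.

(** * Real series with bounded partial sums and dominated convergence *)

Section RealSeries.
Variable R : realType.
Implicit Types d : nat -> R.

Lemma ler_sum_widen d m n : (forall i, 0 <= d i) -> (m <= n)%N ->
  \sum_(i < m) d i <= \sum_(i < n) d i.
Proof.
move=> d0 mn; rewrite -(subnKC mn) big_split_ord /= lerDl; exact: sumr_ge0.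
Qed.

(** [M0] is an index at which the partial sums come within [e] of their supremum. *)
Lemma bounded_series_tail d B : (forall i, 0 <= d i) ->
  (forall N, \sum_(i < N) d i <= B) -> forall e : R, 0 < e ->
  exists M0, forall M, \sum_(i < M) d i <= \sum_(i < M0) d i + e.
Proof.
move=> d0 dB e e0.
have sE : has_sup (range (fun N => \sum_(i < N) d i)).
  by split; [exists (\sum_(i < 0) d i), 0%N|exists B => _ [N _ <-]].
have [_ [M0 _ <-] h] := sup_adherent e0 sE.
exists M0 => M; rewrite -lerBlDr.
apply: le_trans (ltW h); rewrite lerD2r.
by apply: ub_le_sup; [case: sE|exists M].
Qed.

(** Dominated convergence for series, uniform in the number [M] of terms: the tail of [d] takes care
    of all but finitely many columns, and each remaining column tends to zero by itself. *)
Lemma tannery d B (c : nat -> nat -> R) : (forall N m, 0 <= c N m <= d m) ->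
  (forall N, \sum_(i < N) d i <= B) ->
  (forall m (e : R), 0 < e -> exists N0, forall N, (N0 <= N)%N -> c N m <= e) ->
  forall e : R, 0 < e -> exists N0, forall N, (N0 <= N)%N ->
    forall M, \sum_(m < M) c N m <= e.
Proof.
move=> cd dB c0 e e0.
have d0 i : 0 <= d i by case/andP: (cd 0%N i); exact: le_trans.
have e2 : 0 < e / 2 by lra.
have [M0 tail] := bounded_series_tail d B d0 dB _ e2.
have [N0 hN0] : exists N0, forall N, (N0 <= N)%N -> \sum_(m < M0) c N m <= e / 2.
  elim: M0 (e / 2) e2 {tail} => [|M0 IH] e1 e10.
    by exists 0%N => N _; rewrite big_ord0 ltW.
  have e12 : 0 < e1 / 2 by lra.
  have [N1 h1] := IH _ e12; have [N2 h2] := c0 M0 _ e12.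
  exists (maxn N1 N2) => N; rewrite geq_max => /andP[/h1 {}h1 /h2 {}h2].
  by rewrite big_ord_recr /=; lra.
exists N0 => N /hN0 hN M.
apply: (@le_trans _ _ (\sum_(m < M0 + M) c N m)).
  by apply: ler_sum_widen; [move=> i; case/andP: (cd N i)|exact: leq_addl].
have := tail (M0 + M)%N; rewrite !big_split_ord /=.
have : \sum_(i < M) c N (M0 + i)%N <= \sum_(i < M) d (M0 + i)%N.
  by apply: ler_sum => i _; case/andP: (cd N (M0 + i)%N).
lra.
Qed.

Lemma cvg_series_dominated (r : nat -> R) d B : (forall i, `|r i| <= d i) ->
  (forall N, \sum_(i < N) d i <= B) -> exists s : R, forall e : R, 0 < e ->
  exists N0, forall N, (N0 <= N)%N -> `|s - \sum_(i < N) r i| <= e.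
Proof.
move=> rd dB.
have cr : cvgn (series r).
  apply: (@normed_cvg R R^o); apply: nondecreasing_is_cvgn.
    by apply: nondecreasing_series => i _ _; exact: normr_ge0.
  exists B => _ [N _ <-]; change (\sum_(0 <= i < N) `|r i| <= B); rewrite big_mkord.
  by apply: le_trans (dB N); apply: ler_sum => i _; exact: rd.
exists (limn (series r)) => e e0.
have /cvgrPdist_le/(_ _ e0)[N0 _ h] := cr.
by exists N0 => N /h /=; rewrite /series /= big_mkord.
Qed.

End RealSeries.

(** * Complex series and their Cauchy products *)

Section ComplexSeries.
Variable R : realType.
Implicit Types (a b : nat -> Cplx R) (s t : Cplx R).

Definition is_csum a s := forall e : R, 0 < e ->
  exists N0, forall N, (N0 <= N)%N -> cabs (s - \sum_(i < N) a i) <= e.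

Definition abs_summable a := exists B : R, forall N, \sum_(i < N) cabs (a i) <= B.

Lemma cabs_le0 (z : Cplx R) : (forall e : R, 0 < e -> cabs z <= e) -> z = 0.
Proof.
move=> h; apply: cabs_eq0; apply/eqP; rewrite eq_le cabs_ge0 andbT.
by apply/ler_addgt0Pr => e e0; rewrite add0r h.
Qed.

Lemma is_csum_unique a s t : is_csum a s -> is_csum a t -> s = t.
Proof.
move=> hs ht; apply: subr0_eq; apply: cabs_le0 => e e0.
have e2 : 0 < e / 2 by lra.
have [N1 h1] := hs _ e2; have [N2 h2] := ht _ e2.
have := h1 _ (leq_maxl N1 N2); have := h2 _ (leq_maxr N1 N2).
set S := \sum_(i < _) _ => {}h2 {}h1.
have := le_cabsD _ (s - S) (S - t); rewrite addrA subrK [cabs (S - t)]cabsB; lra.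
Qed.

(** Completeness is taken from the reals: real and imaginary parts are dominated by the modulus and
    summed separately. *)
Lemma abs_summable_is_csum a : abs_summable a -> exists s, is_csum a s.
Proof.
move=> [B aB].
have reB (z : Cplx R) : `|complex.Re z| <= cabs z.
  by rewrite -sqrtr_sqr ler_wsqrtr// lerDl sqr_ge0.
have imB (z : Cplx R) : `|complex.Im z| <= cabs z.
  by rewrite -sqrtr_sqr ler_wsqrtr// lerDr sqr_ge0.
have [s hs] := cvg_series_dominated _ (fun i => complex.Re (a i)) _ B (fun i => reB (a i)) aB.
have [t ht] := cvg_series_dominated _ (fun i => complex.Im (a i)) _ B (fun i => imB (a i)) aB.
exists (s +i* t)%C => e e0.
have e2 : 0 < e / 2 by lra.
have [N1 h1] := hs _ e2; have [N2 h2] := ht _ e2.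
exists (maxn N1 N2) => N; rewrite geq_max => /andP[/h1 {}h1 /h2 {}h2].
have -> : (s +i* t)%C - \sum_(i < N) a i =
  ((s - \sum_(i < N) complex.Re (a i)) +i* (t - \sum_(i < N) complex.Im (a i)))%C :> Cplx R.
  elim: (N) => [|n IH]; first by rewrite !big_ord0 !subr0.
  rewrite !big_ord_recr /= opprD addrA IH; case: (a n) => x y /=.
  by apply/eqP; rewrite eq_complex /= !opprD !addrA !eqxx.
set x := s - _ in h1 *; set y := t - _ in h2 *.
have -> : (x +i* y)%C = x%:C%C + (0 +i* y)%C :> Cplx R.
  by apply/eqP; rewrite eq_complex /= addr0 add0r !eqxx.
apply: le_trans (le_cabsD _ _ _) _.
by rewrite cabs_real /cabs /= expr0n add0r sqrtr_sqr; lra.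
Qed.

Lemma is_csumD a b s t : is_csum a s -> is_csum b t -> is_csum (fun i => a i + b i) (s + t).
Proof.
move=> hs ht e e0; have e2 : 0 < e / 2 by lra.
have [N1 h1] := hs _ e2; have [N2 h2] := ht _ e2.
exists (maxn N1 N2) => N; rewrite geq_max => /andP[/h1 {}h1 /h2 {}h2].
rewrite big_split /= opprD addrACA; apply: le_trans (le_cabsD _ _ _) _; lra.
Qed.

Lemma is_csumZ a s (c : Cplx R) : is_csum a s -> is_csum (fun i => c * a i) (c * s).
Proof.
move=> hs e e0; have c0 := cabs_ge0 _ c.
have ec : 0 < e / (cabs c + 1) by apply: divr_gt0 => //; lra.
have [N0 h] := hs _ ec; exists N0 => N /h {}h.
rewrite -mulr_sumr -mulrBr cabsM.
apply: (@le_trans _ _ ((cabs c + 1) * (e / (cabs c + 1)))).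
  by apply: ler_pM => //; [exact: cabs_ge0|lra].
by rewrite mulrC divfK// gt_eqF//; lra.
Qed.

Lemma is_csum_le a s (B : R) : is_csum a s -> (forall N, \sum_(i < N) cabs (a i) <= B) ->
  cabs s <= B.
Proof.
move=> hs aB; apply/ler_addgt0Pr => e e0; have [N h] := hs _ e0.
have := h _ (leqnn N); have := le_cabsBl _ s (\sum_(i < N) a i).
have := le_trans (cabs_sum _ N (fun i => a i)) (aB N); lra.
Qed.

(** The error at [N] is (s - S_N) t plus the sum of a_i times the remainder of [b] after N - i
    terms. These remainders are bounded by 2B and tend to zero, so [tannery] with majorant 2B |a_i|
    makes the second part small. *)
Lemma is_csum_cauchy_product a b s t : abs_summable a -> abs_summable b ->
  is_csum a s -> is_csum b t ->
  is_csum (fun n => \sum_(i < n.+1) a i * b (n - i)%N) (s * t).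
Proof.
move=> [A aA] [B bB] hs ht.
pose T k := cabs (t - \sum_(j < k) b j).
have TB k : T k <= B + B.
  apply: le_trans (le_cabsD _ _ _) _; rewrite cabsN; apply: lerD.
    exact: is_csum_le ht bB.
  exact: le_trans (cabs_sum _ _ _) (bB k).
have T0 k : 0 <= T k by exact: cabs_ge0.
have B0 : 0 <= B by apply: le_trans (bB 0%N); rewrite big_ord0.
have B1 : 0 < B + 1 by lra.
move=> e e0; have e2 : 0 < e / 2 by lra.
have [N1 h1] : exists N1, forall N, (N1 <= N)%N ->
    forall M, \sum_(i < M) cabs (a i) * T (N - i)%N <= e / 2.
  apply: (@tannery R (fun i => cabs (a i) * (B + B)) (A * (B + B))
    (fun N i => cabs (a i) * T (N - i)%N)) e2 => [N m|N|m e1 e10].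
  - by rewrite mulr_ge0 ?cabs_ge0//= ler_wpM2l ?cabs_ge0.
  - by rewrite -mulr_suml ler_wpM2r// addr_ge0.
  have am0 := cabs_ge0 _ (a m).
  have [N0 h] := ht (e1 / (cabs (a m) + 1)) (divr_gt0 e10 (ltr_wpDl am0 ltr01)).
  exists (N0 + m)%N => N hN; have /h {}h : (N0 <= N - m)%N by move: hN; lia.
  apply: (@le_trans _ _ ((cabs (a m) + 1) * (e1 / (cabs (a m) + 1)))).
    by apply: ler_pM => //; lra.
  by rewrite mulrC divfK// gt_eqF//; lra.
have [N2 h2] := hs _ (divr_gt0 e2 B1).
exists (maxn N1 N2) => N; rewrite geq_max => /andP[/h1 {}h1 /h2 {}h2].
rewrite (sum_triangle _ (fun i j => a i * b j)).
have -> : s * t - \sum_(i < N) \sum_(j < N - i) a i * b j =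
   (s - \sum_(i < N) a i) * t + \sum_(i < N) a i * (t - \sum_(j < N - i) b j).
  under [X in _ = _ + X]eq_bigr do rewrite mulrBr mulr_sumr.
  by rewrite sumrB mulrBl -mulr_suml addrA subrK.
apply: le_trans (le_cabsD _ _ _) _.
have tB : cabs t <= B + 1 by apply: le_trans (is_csum_le _ _ _ ht bB) _; lra.
have l1 : cabs ((s - \sum_(i < N) a i) * t) <= e / 2.
  rewrite cabsM; apply: (@le_trans _ _ (e / 2 / (B + 1) * (B + 1))).
    by apply: ler_pM; rewrite ?cabs_ge0.
  by rewrite divfK// gt_eqF.
have l2 : cabs (\sum_(i < N) a i * (t - \sum_(j < N - i) b j)) <= e / 2.
  apply: le_trans (cabs_sum _ _ _) _; apply: le_trans (h1 N).
  by apply: ler_sum => i _; rewrite cabsM.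
lra.
Qed.

End ComplexSeries.
Arguments is_csum {R} a s.
Arguments abs_summable {R} a.

(** * The seminorms and the algebra *)

Section Seminorms.
Variable R : realType.
Implicit Types (K : set (Cplx R)) (g : Cplx R -> Cplx R) (f : qseries R).
Implicit Types (rho B M : R).

Lemma supnorm_leP K g M : 0 <= M ->
  (supnorm K g <= M%:E)%E <-> forall z, K z -> cabs (g z) <= M.
Proof.
move=> M0; split.
  move=> h z Kz; rewrite -lee_fin; apply: le_trans h.
  by apply: ereal_sup_ubound; right; exists z.
by move=> h; apply: ub_ereal_sup => _ [->|[z /h gM <-]]; rewrite lee_fin.
Qed.

Lemma supnorm_ge0 K g : (0 <= supnorm K g)%E.
Proof. by apply: ereal_sup_ubound; left. Qed.

(** This is the sup norm only for [g] bounded on [K]: [fine] sends +oo to [0]. Hence the bound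
    required in [le_rsup]. *)
Definition rsup K g : R := fine (supnorm K g).

Lemma rsup_ge0 K g : 0 <= rsup K g.
Proof. by apply: fine_ge0; exact: supnorm_ge0. Qed.

Lemma rsup_leP K g M : 0 <= M -> (forall z, K z -> cabs (g z) <= M) -> rsup K g <= M.
Proof.
move=> M0 /(supnorm_leP _ _ _ M0) h; rewrite /rsup -lee_fin fineK//.
rewrite ge0_fin_numE ?supnorm_ge0//; exact: le_lt_trans (ltry M).
Qed.

Lemma le_rsup K g M z : (forall z, K z -> cabs (g z) <= M) -> K z -> cabs (g z) <= rsup K g.
Proof.
move=> h Kz; have M0 : 0 <= M := le_trans (cabs_ge0 _ _) (h z Kz).
suff /(_ z Kz) : forall z, K z -> cabs (g z) <= rsup K g by [].
apply/supnorm_leP; first exact: rsup_ge0.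
rewrite /rsup fineK// ge0_fin_numE ?supnorm_ge0//.
by apply: le_lt_trans (ltry M); apply/supnorm_leP.
Qed.

(** Seminorm bounds are traded for summable real majorants of the terms, so that later estimates are
    finite sums of real numbers rather than series of extended reals. *)
Definition majorant K rho f (d : nat -> R) :=
  (forall n, 0 <= d n) /\ forall n z, K z -> cabs (f n z) * rho ^+ n <= d n.

Lemma pKr_leP K rho f B : 0 < rho -> (pKr K rho f <= B%:E)%E <->
  exists2 d, majorant K rho f d & forall N, \sum_(i < N) d i <= B.
Proof.
move=> rho0; have t0 n : (0 <= supnorm K (f n) * (rho ^+ n)%:E)%E.
  by rewrite mule_ge0 ?supnorm_ge0// lee_fin exprn_ge0// ltW.
split=> [h|[d [d0 fd] dB]].
  have sB N : (\sum_(0 <= i < N) supnorm K (f i) * (rho ^+ i)%:E <= B%:E)%E.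
    by apply: le_trans h; apply: nneseries_lim_ge => n _ _.
  have tf n : (supnorm K (f n) * (rho ^+ n)%:E)%E \is a fin_num.
    rewrite ge0_fin_numE//; apply: le_lt_trans (ltry B); apply: le_trans (sB n.+1).
    by rewrite big_nat_recr//= leeDr// sume_ge0.
  exists (fun n => fine (supnorm K (f n) * (rho ^+ n)%:E)%E); last first.
    move=> N; rewrite -lee_fin; apply: le_trans (sB N); rewrite big_mkord -sumEFin.
    by rewrite lee_sum// => i _; rewrite fineK.
  split=> [n|n z Kz]; first exact: fine_ge0.
  rewrite -lee_fin fineK// EFinM; apply: lee_wpmul2r.
    by rewrite lee_fin exprn_ge0// ltW.
  by apply: ereal_sup_ubound; right; exists z.
apply: lime_le; first by apply: is_cvg_nneseries.
apply: nearW => N /=; rewrite big_mkord.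
apply: (@le_trans _ _ (\sum_(i < N) (d i)%:E)%E); last by rewrite sumEFin lee_fin.
apply: lee_sum => i _.
have rn : 0 < rho ^+ i by exact: exprn_gt0.
have di0 : 0 <= d i / rho ^+ i by rewrite divr_ge0 ?d0 ?(ltW rn).
rewrite -lee_pdivlMr// -EFinM; apply/(supnorm_leP _ _ _ di0) => z Kz.
by rewrite ler_pdivlMr// fd.
Qed.

Lemma pKr_ge0 K rho f : 0 < rho -> (0 <= pKr K rho f)%E.
Proof.
move=> rho0; apply: nneseries_ge0 => n _ _.
by rewrite mule_ge0 ?supnorm_ge0// lee_fin exprn_ge0// ltW.
Qed.

Lemma pKr_ltyP K rho f : 0 < rho -> (pKr K rho f < +oo)%E <->
  exists d B, majorant K rho f d /\ forall N, \sum_(i < N) d i <= B.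
Proof.
move=> rho0; split=> [h|[d [B [fd dB]]]]; last first.
  by apply: le_lt_trans (ltry B); apply/pKr_leP => //; exists d.
have fin : pKr K rho f \is a fin_num by rewrite ge0_fin_numE ?pKr_ge0.
have /(pKr_leP _ _ _ _ rho0)[d fd dB] : (pKr K rho f <= (fine (pKr K rho f))%:E)%E by rewrite fineK.
by exists d, (fine (pKr K rho f)).
Qed.

Lemma pKr_ltP K rho f (e : R) : 0 < rho -> (pKr K rho f < e%:E)%E <->
  exists d B, [/\ majorant K rho f d, forall N, \sum_(i < N) d i <= B & B < e].
Proof.
move=> rho0; split=> [h|[d [B [fd dB Be]]]]; last first.
  by apply: (@le_lt_trans _ _ B%:E); [apply/pKr_leP => //; exists d|rewrite lte_fin].
have fin : pKr K rho f \is a fin_num by rewrite ge0_fin_numE ?pKr_ge0// (lt_trans h)// ltry.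
have /(pKr_leP _ _ _ _ rho0)[d fd dB] : (pKr K rho f <= (fine (pKr K rho f))%:E)%E by rewrite fineK.
by exists d, (fine (pKr K rho f)); split => //; rewrite -lte_fin fineK.
Qed.

(** A single coefficient at a single point is controlled by one seminorm; closedness of the summands
    and continuity of the horizontal characters rest on this. *)
Lemma pKr_coef_lt K rho f (e : R) n z : 0 < rho -> (pKr K rho f < e%:E)%E -> K z ->
  cabs (f n z) * rho ^+ n < e.
Proof.
move=> rho0 /(pKr_ltP _ _ _ _ rho0)[d [B [[d0 fd] dB Be]]] Kz.
apply: le_lt_trans Be; apply: le_trans (fd n z Kz) _.
by apply: le_trans (dB n.+1); rewrite big_ord_recr /= lerDr sumr_ge0.
Qed.

End Seminorms.
Arguments rsup {R} K g.
Arguments majorant {R} K rho f d.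

Lemma finite_support_sum_le (R : realType) (d : nat -> R) N M : (forall i, 0 <= d i) ->
  (forall i, (N <= i)%N -> d i = 0) -> \sum_(i < M) d i <= \sum_(i < N) d i.
Proof.
move=> d0 dN; apply: (@le_trans _ _ (\sum_(i < N + M) d i)).
  by apply: ler_sum_widen => //; exact: leq_addl.
by rewrite big_split_ord /= gerDl big1// => i _; rewrite dN// leq_addr.
Qed.

(** * The algebra structure and the monomials [g(x) y^N] *)

Section Algebra.
Variables (R : realType) (q : Cplx R) (Ux : set (Cplx R)) (ry : \bar R).
Hypotheses (hq1 : cabs q < 1) (hU : qd_open q Ux ry).
Implicit Types (K : set (Cplx R)) (f g h : qseries R) (rho : R).

Lemma open_Ux : open Ux. Proof. by case: hU => -[]. Qed.
Lemma Ux0 : Ux 0. Proof. by case: hU => -[]. Qed.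

Lemma UxM n z : Ux z -> Ux (q ^+ n * z).
Proof.
move=> Uz; case: n => [|n]; first by rewrite expr0 mul1r.
by case: hU => -[_ _ h] _; apply: h.
Qed.

(** This is where q-openness enters the estimates: [Ux] contains both the orbits of [K] and their
    limit [0]. *)
Lemma adm_orbit_hull K rho : adm Ux ry K rho -> adm Ux ry (orbit_hull q K) rho.
Proof.
move=> [cK KU rho0 rhoy]; split => //; first exact: compact_orbit_hull.
move=> _ [[z w] [/= Kz [->|[n _ <-]]] <-]; first by rewrite mulr0; exact: Ux0.
by rewrite mulrC; apply/UxM/KU.
Qed.

Lemma Oq_hol f n : Oq Ux ry f -> holomorphic_on Ux (f n).
Proof. by case. Qed.

Lemma Oq_off f n z : Oq Ux ry f -> ~ Ux z -> f n z = 0.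
Proof. by case=> _ h _; exact: h. Qed.

Lemma Oq_majorant f K rho : Oq Ux ry f -> adm Ux ry K rho ->
  exists d B, majorant K rho f d /\ forall N, \sum_(i < N) d i <= B.
Proof. by move=> [_ _ h] a; apply/pKr_ltyP; [case: a|exact: h]. Qed.

Lemma Oq_intro f : (forall n, holomorphic_on Ux (f n)) ->
  (forall n z, ~ Ux z -> f n z = 0) ->
  (forall K rho, adm Ux ry K rho ->
     exists d B, majorant K rho f d /\ forall N, \sum_(i < N) d i <= B) ->
  Oq Ux ry f.
Proof. by move=> h1 h2 h3; split => // K rho a; apply/pKr_ltyP; [case: a|exact: h3]. Qed.

Lemma Oq_dominated f g : Oq Ux ry f -> (forall n, holomorphic_on Ux (g n)) ->
  (forall n z, ~ Ux z -> g n z = 0) ->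
  (forall n z, Ux z -> cabs (g n z) <= cabs (f n z)) -> Oq Ux ry g.
Proof.
move=> fO hg g0 gf; apply: Oq_intro => // K rho a.
have [_ KU rho0 _] := a.
have [d [B [[d0 fd] dB]]] := Oq_majorant _ _ _ fO a; exists d, B; split => //; split => // n z Kz.
apply: le_trans (fd n z Kz); apply: ler_wpM2r; last exact/gf/KU.
by rewrite exprn_ge0// ltW.
Qed.

Lemma Oq_sadd f g : Oq Ux ry f -> Oq Ux ry g -> Oq Ux ry (sadd f g).
Proof.
move=> fO gO; apply: Oq_intro => [n|n z nz|K rho a].
- by apply: holomorphicD; exact: Oq_hol.
- by rewrite /sadd !(Oq_off _ _ _ _ nz)// addr0.
have [d [B [[d0 fd] dB]]] := Oq_majorant _ _ _ fO a.
have [d' [B' [[d'0 gd] dB']]] := Oq_majorant _ _ _ gO a.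
exists (fun n => d n + d' n), (B + B'); split; last first.
  by move=> N; rewrite big_split; apply: lerD; [exact: dB|exact: dB'].
split=> [n|n z Kz]; first exact: addr_ge0.
apply: (@le_trans _ _ ((cabs (f n z) + cabs (g n z)) * rho ^+ n)).
  by apply: ler_wpM2r; [case: a => _ _ r0 _; rewrite exprn_ge0// ltW|exact: le_cabsD].
by rewrite mulrDl; apply: lerD; [exact: fd|exact: gd].
Qed.

Lemma Oq_sscale (c : Cplx R) f : Oq Ux ry f -> Oq Ux ry (sscale c f).
Proof.
move=> fO; apply: Oq_intro => [n|n z nz|K rho a].
- by apply: holomorphicM; [exact: holomorphic_cst|exact: Oq_hol].
- by rewrite /sscale (Oq_off _ _ _ fO nz) mulr0.
have [d [B [[d0 fd] dB]]] := Oq_majorant _ _ _ fO a.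
exists (fun n => cabs c * d n), (cabs c * B); split; last first.
  by move=> N; rewrite -mulr_sumr ler_wpM2l ?cabs_ge0.
split=> [n|n z Kz]; first by rewrite mulr_ge0 ?cabs_ge0.
by rewrite /sscale cabsM -mulrA ler_wpM2l ?cabs_ge0 ?fd//.
Qed.

Lemma ssubE f g : ssub f g = sadd f (sscale (-1) g).
Proof. by apply/funext => n; apply/funext => z; rewrite /ssub /sadd /sscale mulN1r. Qed.

Lemma Oq_ssub f g : Oq Ux ry f -> Oq Ux ry g -> Oq Ux ry (ssub f g).
Proof. by move=> fO gO; rewrite ssubE; apply: Oq_sadd => //; exact: Oq_sscale. Qed.

Lemma smulE f g n z : Ux z -> smul q Ux f g n z = \sum_(i < n.+1) f i z * g (n - i)%N (q ^+ i * z).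
Proof. by move=> Uz; rewrite /smul mem_set. Qed.

Lemma smul_off f g n z : ~ Ux z -> smul q Ux f g n z = 0.
Proof. by move=> Uz; rewrite /smul memNset. Qed.

(** With [H] the orbit hull of [K], the estimate is p_(K,rho)(f g) <= p_(K,rho)(f) p_(H,rho)(g):
    only the right factor is evaluated at dilated points. *)
Lemma Oq_smul f g : Oq Ux ry f -> Oq Ux ry g -> Oq Ux ry (smul q Ux f g).
Proof.
move=> fO gO; apply: Oq_intro => [n|n z nz|K rho a]; last 1 first.
- have [_ KU rho0 _] := a; have r0 k : 0 <= rho ^+ k by rewrite exprn_ge0// ltW.
  have [F [A [[F0 fF] FA]]] := Oq_majorant _ _ _ fO a.
  have [G [B [[G0 gG] GB]]] := Oq_majorant _ _ _ gO (adm_orbit_hull _ _ a).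
  exists (fun n => \sum_(i < n.+1) F i * G (n - i)%N), (A * B); split; last first.
    move=> N; rewrite (sum_triangle _ (fun i j => F i * G j)).
    have B0 : 0 <= B by apply: le_trans (GB 0%N); rewrite big_ord0.
    apply: (@le_trans _ _ (\sum_(i < N) F i * B)).
      by apply: ler_sum => i _; rewrite -mulr_sumr ler_wpM2l.
    by rewrite -mulr_suml ler_wpM2r.
  split=> [n|n z Kz]; first by apply: sumr_ge0 => i _; rewrite mulr_ge0.
  rewrite smulE; last exact: KU.
  apply: (@le_trans _ _ ((\sum_(i < n.+1) cabs (f i z * g (n - i)%N (q ^+ i * z))) * rho ^+ n)).
    by apply: ler_wpM2r => //; exact: cabs_sum.
  rewrite mulr_suml; apply: ler_sum => i _.
  rewrite cabsM (_ : rho ^+ n = rho ^+ i * rho ^+ (n - i)); last by rewrite -exprD subnKC ?leq_ord.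
  rewrite mulrACA.
  apply: ler_pM; rewrite ?mulr_ge0 ?cabs_ge0//; first exact: fF.
  by apply: gG; exact: orbit_hullM.
- apply: (eq_holomorphic _ _ (fun z => \sum_(i < n.+1) f i z * g (n - i)%N (q ^+ i * z))).
  + exact: open_Ux.
  + by move=> z Uz; rewrite smulE.
  apply: (holomorphic_sum _ _ _ (fun i z => f i z * g (n - i)%N (q ^+ i * z))) => i _.
  apply: holomorphicM; first exact: Oq_hol.
  by move=> z Uz; apply: derivable_scale; apply: (Oq_hol g (n - i)%N gO); exact: UxM.
- exact: smul_off.
Qed.

(** Both sides are the sum over i + j + k = n of f_i(z) g_j(q^i z) h_k(q^(i+j) z). *)
Lemma smulA f g h : Oq Ux ry f -> Oq Ux ry g -> Oq Ux ry h ->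
  smul q Ux f (smul q Ux g h) = smul q Ux (smul q Ux f g) h.
Proof.
move=> fO gO hO; apply/funext => n; apply/funext => z.
have [Uz|nUz] := pselect (Ux z); last by rewrite !smul_off.
rewrite !smulE//.
pose E i j := f i z * g j (q ^+ i * z) * h (n - (i + j))%N (q ^+ (i + j) * z).
transitivity (\sum_(i < n.+1) \sum_(j < n.+1 - i) E i j).
  apply: eq_bigr => i _; rewrite smulE; last exact: UxM.
  rewrite subSn 1?leq_ord// mulr_sumr; apply: eq_bigr => j _.
  by rewrite /E mulrA subnDA addnC exprD -!mulrA.
rewrite -sum_triangle; apply: eq_bigr => i _; rewrite smulE// mulr_suml.
by apply: eq_bigr => j _; rewrite /E subnKC// leq_ord.
Qed.

Lemma smulDl f g h : smul q Ux (sadd f g) h = sadd (smul q Ux f h) (smul q Ux g h).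
Proof.
apply/funext => n; apply/funext => z; rewrite /sadd.
have [Uz|nUz] := pselect (Ux z); last by rewrite !smul_off// addr0.
by rewrite !smulE// -big_split /=; apply: eq_bigr => i _; rewrite mulrDl.
Qed.

Lemma smulDr f g h : smul q Ux f (sadd g h) = sadd (smul q Ux f g) (smul q Ux f h).
Proof.
apply/funext => n; apply/funext => z; rewrite /sadd.
have [Uz|nUz] := pselect (Ux z); last by rewrite !smul_off// addr0.
by rewrite !smulE// -big_split /=; apply: eq_bigr => i _; rewrite mulrDr.
Qed.

(** The series g(x) y^N, normalised to zero outside [Ux]. [sone], [sx] and [sy] are instances of it
    by conversion. *)
Definition mono (N : nat) (g : Cplx R -> Cplx R) : qseries R :=
  fun n z => if (n == N)%N && (z \in Ux) then g z else 0.

Lemma monoE N (g : Cplx R -> Cplx R) n z : Ux z -> mono N g n z = if n == N then g z else 0.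
Proof. by move=> Uz; rewrite /mono mem_set// andbT. Qed.

Lemma mono_off N (g : Cplx R -> Cplx R) n z : ~ Ux z -> mono N g n z = 0.
Proof. by move=> Uz; rewrite /mono memNset// andbF. Qed.

Lemma mono_majorant N (g : Cplx R -> Cplx R) K rho M : 0 < rho -> 0 <= M ->
  (forall z, K z -> cabs (g z) <= M) ->
  exists2 d, majorant K rho (mono N g) d & forall n, \sum_(i < n) d i <= M * rho ^+ N.
Proof.
move=> rho0 M0 gM.
have r0 k : 0 <= rho ^+ k by rewrite exprn_ge0// ltW.
exists (fun n => if n == N then M * rho ^+ N else 0).
  split=> [n|n z Kz]; first by case: ifP => // _; rewrite mulr_ge0.
  have [Uz|nUz] := pselect (Ux z); last first.
    by rewrite mono_off// cabs0 mul0r; case: ifP => // _; rewrite mulr_ge0.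
  rewrite monoE//; case: eqP => [->|_]; last by rewrite cabs0 mul0r.
  by rewrite ler_wpM2r ?gM//.
move=> n; apply: (@le_trans _ _ (\sum_(i < N.+1) if i == N :> nat then M * rho ^+ N else 0)).
  apply: (@finite_support_sum_le R (fun i => if i == N then M * rho ^+ N else 0)).
    by move=> i; case: ifP => // _; rewrite mulr_ge0.
  by move=> i Ni; rewrite gtn_eqF.
by rewrite big_ord_recr /= eqxx big1 ?add0r// => i _; rewrite ltn_eqF.
Qed.

Lemma mono_hol N (g : Cplx R -> Cplx R) n : holomorphic_on Ux g -> holomorphic_on Ux (mono N g n).
Proof.
move=> hg; have [nN|nN] := eqVneq n N.
  apply: eq_holomorphic hg; first exact: open_Ux.
  by move=> z Uz; rewrite monoE// nN eqxx.
apply: eq_holomorphic (@holomorphic_cst _ Ux 0); first exact: open_Ux.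
by move=> z Uz; rewrite monoE// (negbTE nN).
Qed.

Lemma Oq_mono N (g : Cplx R -> Cplx R) : holomorphic_on Ux g -> Oq Ux ry (mono N g).
Proof.
move=> hg; apply: Oq_intro => [n|n z nz|K rho [cK KU rho0 _]].
- exact: mono_hol.
- exact: mono_off.
have [M M0 gM] := holomorphic_bounded _ _ _ _ hg cK KU.
by have [d fd dB] := mono_majorant N _ K _ _ rho0 M0 gM; exists d, (M * rho ^+ N).
Qed.

Lemma Oq_sone : Oq Ux ry (sone Ux).
Proof. exact: (Oq_mono 0%N _ (@holomorphic_cst _ Ux 1)). Qed.
Lemma Oq_sx : Oq Ux ry (sx Ux).
Proof. exact: (Oq_mono 0%N _ (@holomorphic_id _ Ux)). Qed.
Lemma Oq_sy : Oq Ux ry (sy Ux).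
Proof. exact: (Oq_mono 1%N _ (@holomorphic_cst _ Ux 1)). Qed.
Lemma Oq_szero : Oq Ux ry (@szero R).
Proof.
apply: Oq_dominated Oq_sone _ _ _ => // [n|n z _]; first exact: holomorphic_cst.
by rewrite cabs0 cabs_ge0.
Qed.

Lemma smul_mono0 (g : Cplx R -> Cplx R) f n z : Ux z -> smul q Ux (mono 0 g) f n z = g z * f n z.
Proof.
move=> Uz; rewrite smulE// big_ord_recl monoE// eqxx /= expr0 mul1r subn0.
by rewrite big1 ?addr0// => i _; rewrite monoE// mul0r.
Qed.

Lemma smul1l f : Oq Ux ry f -> smul q Ux (sone Ux) f = f.
Proof.
move=> fO; apply/funext => n; apply/funext => z.
have [Uz|nUz] := pselect (Ux z); last by rewrite smul_off// (Oq_off _ _ _ fO).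
by rewrite (smul_mono0 (fun _ => 1))// mul1r.
Qed.

Lemma sscaleE (c : Cplx R) f : Oq Ux ry f -> sscale c f = smul q Ux (mono 0 (fun _ => c)) f.
Proof.
move=> fO; apply/funext => n; apply/funext => z; rewrite /sscale.
have [Uz|nUz] := pselect (Ux z); last by rewrite smul_off// (Oq_off _ _ _ fO)// mulr0.
by rewrite smul_mono0.
Qed.

(** The commutation rule y^m h(x) = h(q^m x) y^m, of which y x = q x y is a case. *)
Lemma smul_mono (g h : Cplx R -> Cplx R) m n :
  smul q Ux (mono m g) (mono n h) = mono (m + n)%N (fun z => g z * h (q ^+ m * z)).
Proof.
apply/funext => k; apply/funext => z.
have [Uz|nUz] := pselect (Ux z); last by rewrite smul_off// mono_off.
rewrite smulE// [RHS]monoE//.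
have [mk|km] := leqP m k.
  rewrite (bigD1 (Ordinal (mk : m < k.+1)%N))//= !monoE ?eqxx//; last exact: UxM.
  rewrite big1 ?addr0; last first.
    by move=> i /negbTE im; rewrite monoE// (im : (i == m :> nat) = false) mul0r.
  by rewrite -(eqn_add2l m) subnKC//; case: ifP; rewrite ?mulr0.
rewrite ltn_eqF ?ltn_addr// big1// => i _; rewrite monoE// ltn_eqF ?mul0r//.
exact: leq_trans (ltn_ord i) km.
Qed.

End Algebra.
Arguments mono {R} Ux N g.

(** * Left inverses modulo the radical *)

(** Summing the recursion up to [N] bounds the partial sum by v_0, plus [B] times the v_i with i <
    i0, plus half of the partial sum itself. The half is absorbed on the left, whence the factor
    2. *)
Lemma recursive_series_bounded (R : realType) (v : nat -> R) (c : nat -> nat -> R) B i0 :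
  (forall n, 0 <= v n) -> (forall i m, 0 <= c i m) ->
  (forall i M, \sum_(m < M) c i m <= B) ->
  (forall i, (i0 <= i)%N -> forall M, \sum_(m < M) c i m <= 1 / 2) ->
  (forall n, v n.+1 <= \sum_(i < n.+1) v i * c i (n - i).+1) ->
  exists C, forall N, \sum_(i < N) v i <= C.
Proof.
move=> v0 c0 cB cs vrec.
have B0 : 0 <= B by apply: le_trans (cB 0%N 0%N); rewrite big_ord0.
(* [d] pays for the finitely many rows that do not yet contract. *)
pose d i := if (i < i0)%N then v i * B else 0.
exists (2 * (v 0%N + \sum_(i < i0) d i)) => N.
have SN : \sum_(i < N) v i <= \sum_(i < N.+1) v i by apply: ler_sum_widen.
have : \sum_(i < N.+1) v i <= v 0%N + (\sum_(i < N) d i + \sum_(i < N) v i / 2).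
  rewrite big_ord_recl lerD2l.
  apply: (@le_trans _ _ (\sum_(n < N) \sum_(i < n.+1) v i * c i (n - i).+1)).
    by apply: ler_sum => i _; exact: vrec.
  rewrite (sum_triangle _ (fun i j => v i * c i j.+1)) -big_split /=.
  apply: ler_sum => i _; rewrite -mulr_sumr.
  have cS : \sum_(j < N - i) c i j.+1 <= \sum_(j < (N - i).+1) c i j.
    by rewrite [leRHS]big_ord_recl /= lerDr.
  rewrite /d; case: ltnP => ii0.
    apply: (@le_trans _ _ (v i * B)); last by rewrite lerDl divr_ge0.
    by apply: ler_wpM2l => //; apply: le_trans cS _; exact: cB.
  rewrite add0r; apply: ler_wpM2l => //; apply: le_trans cS _.
  by rewrite -[leRHS]mul1r; exact: cs.
have : \sum_(i < N) d i <= \sum_(i < i0) d i.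
  apply: finite_support_sum_le => i; rewrite /d.
    by case: ifP => // _; rewrite mulr_ge0.
  by move=> ii0; rewrite ltnNge ii0.
by rewrite -mulr_suml; lra.
Qed.

Section RadicalInverse.
Variables (R : realType) (q : Cplx R) (Ux : set (Cplx R)) (ry : \bar R).
Hypotheses (hq1 : cabs q < 1) (hU : qd_open q Ux ry).
Variable h : qseries R.
Hypothesis hR : rad_part Ux ry h.

Let hO : Oq Ux ry h. Proof. by case: hR. Qed.

(** The points of [K] have bounded modulus, so all q^i z enter a given neighbourhood of [0] from a
    common index on; there h_m is close to h_m(0) = 0. *)
Lemma rad_coef_small m (K : set (Cplx R)) : compact K -> forall e : R, 0 < e ->
  exists N, forall i, (N <= i)%N -> forall z, K z -> cabs (h m (q ^+ i * z)) <= e.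
Proof.
move=> cK e e0; have [M M0 KM] := compact_cabs_bounded _ _ cK.
have [d d0 hd] := continuous_cabsP _ _ _
  (holomorphic_continuous _ _ _ _ (Oq_hol _ _ _ _ m hO) (Ux0 _ _ _ _ hU)) _ e0.
have M1 : 0 < M + 1 by lra.
have [N qN] := geometric_small _ _ _ (cabs_ge0 _ q) hq1 (divr_gt0 d0 M1).
exists N => i /qN qi z /KM zM; have [_ [_ h0]] := hR.
have := hd (q ^+ i * z); rewrite h0 !subr0 => {}hd; apply/ltW/hd.
rewrite cabsM cabsX; apply: (@le_lt_trans _ _ (cabs q ^+ i * (M + 1))).
  by apply: ler_wpM2l; [rewrite exprn_ge0 ?cabs_ge0|lra].
by rewrite -ltr_pdivlMr.
Qed.

(* [quasi_inverse n] is the [y^n]-coefficient of the geometric series [1 + h + h^2 + ...],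
   computed by the recursion [u = 1 + u h]; [inverse_upto n] tabulates the first [n + 1] of them. *)
Fixpoint inverse_upto (n : nat) : qseries R :=
  if n is n'.+1 then fun k z =>
    if k == n then
      if z \in Ux then \sum_(i < n'.+1) inverse_upto n' i z * h (n - i)%N (q ^+ i * z) else 0
    else inverse_upto n' k z
  else sone Ux.

Definition quasi_inverse : qseries R := fun n => inverse_upto n n.

(** Each stage writes only the entry at its own index and copies all others. *)
Lemma inverse_upto_stable n i z : (i <= n)%N -> inverse_upto n i z = quasi_inverse i z.
Proof.
elim: n i => [|n IH] i; first by rewrite leqn0 => /eqP ->.
rewrite leq_eqVlt => /orP[/eqP -> //|]; rewrite ltnS => iin.
by rewrite /= ltn_eqF ?ltnS// IH.
Qed.

Lemma quasi_inverseS n z : Ux z ->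
  quasi_inverse n.+1 z = \sum_(i < n.+1) quasi_inverse i z * h (n.+1 - i)%N (q ^+ i * z).
Proof.
move=> Uz; rewrite {1}/quasi_inverse /= eqxx mem_set//; apply: eq_bigr => i _.
by rewrite inverse_upto_stable// -ltnS.
Qed.

Lemma quasi_inverse_off n z : ~ Ux z -> quasi_inverse n z = 0.
Proof.
by move=> Uz; case: n => [|n]; rewrite /quasi_inverse /= /sone ?eqxx memNset.
Qed.

Lemma quasi_inverse_hol n : holomorphic_on Ux (quasi_inverse n).
Proof.
have oU := open_Ux _ _ _ _ hU.
elim/ltn_ind: n => -[_|n IH]; first exact: (Oq_hol _ _ _ _ 0%N (Oq_sone _ _ _ _ hU)).
apply: (eq_holomorphic _ _
  (fun z => \sum_(i < n.+1) quasi_inverse i z * h (n.+1 - i)%N (q ^+ i * z)) _ oU).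
  by move=> z Uz; rewrite quasi_inverseS.
apply: (holomorphic_sum _ _ _ (fun i z => quasi_inverse i z * h (n.+1 - i)%N (q ^+ i * z))) => i ni.
apply: holomorphicM; first exact: IH.
move=> z Uz; apply: derivable_scale; apply: (Oq_hol _ _ _ _ (n.+1 - i)%N hO).
exact: UxM hU _ _ Uz.
Qed.

Lemma Oq_quasi_inverse : Oq Ux ry quasi_inverse.
Proof.
apply: Oq_intro; [exact: quasi_inverse_hol|exact: quasi_inverse_off|move=> K rho a].
have [cK KU rho0 _] := a; have r0 k : 0 < rho ^+ k by rewrite exprn_gt0.
have [d [B [[d0 hd] dB]]] := Oq_majorant _ _ _ _ _ _ hO (adm_orbit_hull _ _ _ _ hq1 hU _ _ a).
pose hq i m z := h m (q ^+ i * z).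
have hqd i m z : K z -> cabs (hq i m z) <= d m / rho ^+ m.
  by move=> Kz; rewrite ler_pdivlMr// hd//; exact: orbit_hullM.
pose v n := rsup K (quasi_inverse n) * rho ^+ n.
pose c i m := rsup K (hq i m) * rho ^+ m.
have v0 n : 0 <= v n by rewrite mulr_ge0 ?rsup_ge0// ltW.
have c0 i m : 0 <= c i m by rewrite mulr_ge0 ?rsup_ge0// ltW.
have cd i m : 0 <= c i m <= d m.
  rewrite c0 /c -ler_pdivlMr//; apply: rsup_leP; last exact: hqd.
  by rewrite divr_ge0// ltW.
(* The recursion keeps each coefficient holomorphic, hence bounded on [K], so its [rsup] is a
   genuine supremum. *)
have uK n z : K z -> cabs (quasi_inverse n z) <= rsup K (quasi_inverse n).
  have [M _ uM] := holomorphic_bounded _ _ _ _ (quasi_inverse_hol n) cK KU.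
  by move=> Kz; apply: le_rsup uM Kz.
have [i0 hi0] : exists i0, forall i, (i0 <= i)%N -> forall M, \sum_(m < M) c i m <= 1 / 2.
  apply: (tannery _ d B c cd dB); last by lra.
  move=> m e e0; have [N hN] := rad_coef_small m K cK _ (divr_gt0 e0 (r0 m)).
  exists N => i /hN hi; rewrite /c -ler_pdivlMr//; apply: rsup_leP => //.
  by rewrite divr_ge0// ltW.
have [C vC] : exists C, forall N, \sum_(i < N) v i <= C.
  apply: (recursive_series_bounded _ v c B i0 v0 c0 _ hi0) => [i M|n].
    by apply: le_trans (dB M); apply: ler_sum => m _; case/andP: (cd i m).
  (* The weight rho^(n+1) splits as rho^i rho^(n+1-i), one factor for [v] and one for [c]. *)
  rewrite /v /c (_ : \sum_(i < n.+1) _ =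
    (\sum_(i < n.+1) rsup K (quasi_inverse i) * rsup K (hq i (n - i).+1)) * rho ^+ n.+1).
    apply: ler_wpM2r; first exact: ltW.
    apply: rsup_leP => [|z Kz].
      by apply: sumr_ge0 => i _; rewrite mulr_ge0 ?rsup_ge0.
    rewrite quasi_inverseS; last exact: KU.
    apply: le_trans (cabs_sum _ _ _) _; apply: ler_sum => i _.
    rewrite cabsM subSn -1?ltnS//; apply: ler_pM; rewrite ?cabs_ge0 ?uK//.
    by apply: (le_rsup _ _ (hq i (n - i).+1) _ _ (hqd i _) Kz).
  rewrite mulr_suml; apply: eq_bigr => i _.
  rewrite (_ : rho ^+ n.+1 = rho ^+ i * rho ^+ (n - i).+1) 1?mulrACA//.
  by rewrite -exprD addnS subnKC// -ltnS.
exists v, C; split => //; split => // n z Kz.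
by apply: ler_wpM2r; [exact: ltW|exact: uK].
Qed.

Lemma smul_quasi_inverse : smul q Ux quasi_inverse (ssub (sone Ux) h) = sone Ux.
Proof.
apply/funext => n; apply/funext => z.
have [Uz|nUz] := pselect (Ux z); last by rewrite smul_off// /sone memNset// andbF.
have [_ [h00 _]] := hR; have Uqz i : Ux (q ^+ i * z) by exact: UxM hU _ _ Uz.
(* The last summand is u_n, as 1 - h has constant coefficient 1. The remaining ones are the
   recursion for u_n with opposite sign. *)
rewrite smulE// big_ord_recr /= subnn /ssub h00 /sone eqxx mem_set//= subr0 mulr1.
case: n => [|n]; first by rewrite big_ord0 add0r /quasi_inverse /= /sone mem_set.
rewrite quasi_inverseS// -big_split big1// => i _ /=.
rewrite subSn -1?ltnS//= sub0r mulrN addNr//.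
Qed.

End RadicalInverse.

(** * The direct sum decomposition *)

Lemma radius_between (R : realType) (ry : \bar R) (b : R) : (b%:E < ry)%E ->
  exists2 rho : R, b < rho & (rho%:E < ry)%E.
Proof.
case: ry => [r|_|//]; last by exists (b + 1); rewrite ?ltry// ltrDl.
by rewrite lte_fin => br; exists ((b + r) / 2); rewrite ?lte_fin; lra.
Qed.

Section Decomposition.
Variables (R : realType) (q : Cplx R) (Ux : set (Cplx R)) (ry : \bar R).
Hypothesis hU : qd_open q Ux ry.
Implicit Types (K : set (Cplx R)) (f g : qseries R) (rho : R).

Lemma adm_finite K : finite_set K -> K `<=` Ux -> exists rho, adm Ux ry K rho.
Proof.
move=> fK KU; have [_ /radius_between[rho rho0 rhoy]] := hU.
by exists rho; split => //; exact: finite_compact.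
Qed.

Lemma adm_setU0 K rho : adm Ux ry K rho -> adm Ux ry (K `|` [set 0]) rho.
Proof.
move=> [cK KU rho0 rhoy]; split => //.
  by apply: compactU => //; exact/finite_compact/finite_set1.
by move=> z [/KU//|->]; exact: Ux0 hU.
Qed.

(** The projections involve f_n(0) even when [K] misses [0]; adding [0] to the compact set costs a
    factor 2. *)
Lemma majorant_setU0 K rho f g d : 0 < rho ->
  (forall n z, K z -> cabs (g n z) <= cabs (f n z) + cabs (f n 0)) ->
  majorant (K `|` [set 0]) rho f d -> majorant K rho g (fun n => 2 * d n).
Proof.
move=> rho0 gf [d0 fd]; split=> [n|n z Kz]; first by have := d0 n; lra.
apply: (@le_trans _ _ ((cabs (f n z) + cabs (f n 0)) * rho ^+ n)).
  by apply: ler_wpM2r; [rewrite exprn_ge0// ltW|exact: gf].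
by have := fd n z (or_introl Kz); have := fd n 0 (or_intror erefl); lra.
Qed.

Lemma Oq_dominated0 f g : Oq Ux ry f -> (forall n, holomorphic_on Ux (g n)) ->
  (forall n z, ~ Ux z -> g n z = 0) ->
  (forall n z, Ux z -> cabs (g n z) <= cabs (f n z) + cabs (f n 0)) -> Oq Ux ry g.
Proof.
move=> fO hg g0 gf; apply: Oq_intro => // K rho a; have [_ KU rho0 _] := a.
have [d [B [fd dB]]] := Oq_majorant _ _ _ _ _ _ fO (adm_setU0 _ _ a).
exists (fun n => 2 * d n), (2 * B); split.
  by apply: majorant_setU0 fd => // n z /KU; exact: gf.
by move=> N; rewrite -mulr_sumr; have := dB N; lra.
Qed.

Lemma Oq_continuous_dominated0 (P : qseries R -> qseries R) :
  (forall f g n z, Ux z -> cabs (ssub (P g) (P f) n z) <=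
     cabs (ssub g f n z) + cabs (ssub g f n 0)) -> Oq_continuous Ux ry P.
Proof.
move=> hP f _ K rho eps a eps0; have [_ KU rho0 _] := a.
exists 1%N, (fun _ => K `|` [set 0]), (fun _ => rho), (eps / 2); split.
  by split; [move=> i _; exact: adm_setU0|lra].
move=> g _ /(_ 0%N isT)/(pKr_ltP _ _ _ _ _ rho0)[d [B [fd dB Be]]].
apply/pKr_ltP => //; exists (fun n => 2 * d n), (2 * B); split; last by lra.
  by apply: majorant_setU0 fd => // n z /KU; exact: hP.
by move=> N; rewrite -mulr_sumr; have := dB N; lra.
Qed.

(** Each summand is cut out by relations f_n(z) = c f_n(w): vanishing is c = 0, constancy of a
    coefficient is w = 0 and c = 1. Such a relation survives limits because two point values are
    continuous. *)
Lemma Oq_closed_relation (S : set (qseries R)) : S `<=` Oq Ux ry ->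
  (forall f, Oq Ux ry f -> ~ S f -> exists n z w (c : Cplx R),
     [/\ Ux z, Ux w, f n z - c * f n w != 0 &
         forall g, S g -> g n z - c * g n w = 0]) ->
  Oq_closed Ux ry S.
Proof.
move=> SO hS; split => // f fO /(hS f fO)[n [z [w [c [Uz Uw fn0 Sn]]]]].
have [||rho a] := @adm_finite [set z; w]; first exact: finite_set2.
  by move=> _ [->|->].
have [_ _ rho0 _] := a; have c0 := cabs_ge0 _ c.
have rn : 0 < rho ^+ n by exact: exprn_gt0.
(* Errors below [delta] at [z] and [w] change the defect, weighted by rho^n, by less than delta (1 +
   |c|), which is the weighted defect of [f]. *)
pose delta := cabs (f n z - c * f n w) * rho ^+ n / (1 + cabs c).
have delta0 : 0 < delta.
  by rewrite divr_gt0 ?mulr_gt0 ?cabs_gt0//; lra.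
exists 1%N, (fun _ => [set z; w]), (fun _ => rho), delta; split; first by split.
move=> g gO /(_ 0%N isT) gf /Sn gn0.
have lz := pKr_coef_lt _ _ _ _ _ n z rho0 gf (or_introl erefl).
have lw := pKr_coef_lt _ _ _ _ _ n w rho0 gf (or_intror erefl).
have : cabs (f n z - c * f n w) * rho ^+ n < delta * (1 + cabs c).
  have -> : f n z - c * f n w = - (ssub g f n z) + c * ssub g f n w.
    by rewrite -[LHS]subr0 -gn0 /ssub; ring.
  apply: (@le_lt_trans _ _ (cabs (ssub g f n z) * rho ^+ n +
     cabs c * (cabs (ssub g f n w) * rho ^+ n))).
    rewrite mulrA -mulrDl; apply: ler_wpM2r; first exact: ltW.
    by apply: le_trans (le_cabsD _ _ _) _; rewrite cabsN cabsM.
  have : cabs c * (cabs (ssub g f n w) * rho ^+ n) <= cabs c * delta.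
    by apply: ler_wpM2l => //; exact: ltW.
  lra.
by rewrite /delta divfK ?ltxx// gt_eqF//; lra.
Qed.

(** * The three projections and the closed summands *)

Definition projA f : qseries R := fun n z => if n == 0%N then f n z else 0.
Definition projI f : qseries R :=
  fun n z => if (n != 0%N) && (z \in Ux) then f n 0 else 0.
Definition projR f : qseries R :=
  fun n z => if (n != 0%N) && (z \in Ux) then f n z - f n 0 else 0.

Lemma projA_continuous : Oq_continuous Ux ry projA.
Proof.
apply: Oq_continuous_dominated0 => f g n z Uz; rewrite /ssub /projA.
case: ifP => _; first by rewrite lerDl cabs_ge0.
by rewrite subrr cabs0 addr_ge0 ?cabs_ge0.
Qed.

Lemma projI_continuous : Oq_continuous Ux ry projI.
Proof.
apply: Oq_continuous_dominated0 => f g n z Uz; rewrite /ssub /projI.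
case: ifP => _; first by rewrite lerDr cabs_ge0.
by rewrite subrr cabs0 addr_ge0 ?cabs_ge0.
Qed.

Lemma projR_continuous : Oq_continuous Ux ry projR.
Proof.
apply: Oq_continuous_dominated0 => f g n z Uz; rewrite /ssub /projR.
case: ifP => _; last by rewrite subrr cabs0 addr_ge0 ?cabs_ge0.
rewrite (_ : _ - _ - _ = (g n z - f n z) - (g n 0 - f n 0)); last by ring.
by apply: le_trans (le_cabsD _ _ _) _; rewrite cabsN.
Qed.

Lemma projA_part f : Oq Ux ry f -> OUx_part Ux ry (projA f).
Proof.
move=> fO; split; last first.
  by move=> n; rewrite lt0n => /negbTE n0; apply/funext => z; rewrite /projA n0.
apply: (Oq_dominated _ _ _ _ _ fO) => [n|n z nz|n z Uz]; rewrite /projA.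
- by case: n => [|n]; [exact: Oq_hol fO|exact: holomorphic_cst].
- by rewrite (Oq_off _ _ _ _ _ _ fO nz) if_same.
- by case: ifP => // _; rewrite cabs0 cabs_ge0.
Qed.

Lemma projI_part f : Oq Ux ry f -> Id_part Ux ry (projI f).
Proof.
move=> fO; split; [|split].
- apply: (Oq_dominated0 _ _ fO) => [n|n z nz|n z Uz]; rewrite /projI.
  + have [->|n0] := eqVneq n 0%N; first exact: holomorphic_cst.
    apply: (eq_holomorphic _ _ (fun _ => f n 0)); first exact: open_Ux hU.
      by move=> z Uz; rewrite mem_set.
    exact: holomorphic_cst.
  + by rewrite memNset// andbF.
  + case: ifP => _; first by rewrite lerDr cabs_ge0.
    by rewrite cabs0 addr_ge0 ?cabs_ge0.
- by apply/funext => z; rewrite /projI.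
- by move=> n; rewrite lt0n => n0; exists (f n 0) => z Uz; rewrite /projI n0 mem_set.
Qed.

Lemma proj_sum f : Oq Ux ry f -> f = sadd (projA f) (sadd (projR f) (projI f)).
Proof.
move=> fO; apply/funext => n; apply/funext => z; rewrite /sadd /projA /projR /projI.
have [Uz|nUz] := pselect (Ux z); last first.
  by rewrite (Oq_off _ _ _ _ _ _ fO nUz) if_same memNset// andbF !addr0.
rewrite mem_set// andbT; case: eqP => _ /=; first by rewrite !addr0.
by rewrite add0r subrK.
Qed.

Lemma projR_part f : Oq Ux ry f -> rad_part Ux ry (projR f).
Proof.
move=> fO; split; [|split].
- rewrite (_ : projR f = ssub f (sadd (projA f) (projI f))).
    apply: Oq_ssub => //; apply: Oq_sadd; first by case: (projA_part _ fO).
    by case: (projI_part _ fO).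
  apply/funext => n; apply/funext => z.
  by rewrite {2}(proj_sum _ fO) /ssub /sadd; ring.
- by apply/funext => z; rewrite /projR.
- by move=> n; rewrite /projR; case: ifP => // _; rewrite subrr.
Qed.

Lemma Id_part_cst f : Id_part Ux ry f -> forall n z, Ux z -> f n z = f n 0.
Proof.
move=> [_ [f0 fc]] [|n] z Uz; first by rewrite f0.
by have [a fa] := fc n.+1 isT; rewrite !fa//; exact: Ux0 hU.
Qed.

Lemma Id_part_intro f : Oq Ux ry f -> f 0%N = (fun _ => 0) ->
  (forall n z, Ux z -> f n z = f n 0) -> Id_part Ux ry f.
Proof. by move=> fO f0 fc; split => //; split => // n _; exists (f n 0) => z; exact: fc. Qed.

(** Degree 0 sees only the first summand, and the values at [0] in positive degree see only the
    constants; the radical summand is what is left. *)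
Lemma decomposition_unique a r i a' r' i' :
  OUx_part Ux ry a -> rad_part Ux ry r -> Id_part Ux ry i ->
  OUx_part Ux ry a' -> rad_part Ux ry r' -> Id_part Ux ry i' ->
  sadd a (sadd r i) = sadd a' (sadd r' i') -> [/\ a = a', r = r' & i = i'].
Proof.
move=> [aO ha] [rO [r0 hr]] iI [aO' ha'] [rO' [r0' hr']] iI' /= E.
have [iO [i0 _]] := iI; have [iO' [i0' _]] := iI'.
have En n z : a n z + (r n z + i n z) = a' n z + (r' n z + i' n z).
  exact: (congr1 (fun f : qseries R => f n z) E).
have aa : a = a'.
  apply/funext => -[|n]; last by rewrite ha// ha'.
  by apply/funext => z; have := En 0%N z; rewrite r0 r0' i0 i0' !addr0.
have ii : i = i'.
  apply/funext => n; apply/funext => z.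
  have [Uz|nUz] := pselect (Ux z); last by rewrite (Oq_off _ _ _ _ _ _ iO nUz) (Oq_off _ _ _ _ _ _ iO' nUz).
  rewrite (Id_part_cst _ iI)// (Id_part_cst _ iI')//.
  by have := En n 0; rewrite aa hr hr' !add0r => /addrI.
split => //; apply/funext => n; apply/funext => z.
by have := En n z; rewrite aa ii => /addrI/addIr.
Qed.

Lemma OUx_part_closed : Oq_closed Ux ry (OUx_part Ux ry).
Proof.
apply: Oq_closed_relation => [f []//|f fO nAf].
apply: contrapT => h; apply: nAf; split => // n n0; apply/funext => z.
have [Uz|nUz] := pselect (Ux z); last exact: Oq_off fO nUz.
apply: contrapT => fnz; apply: h; exists n, z, z, 0; split => //.
  by rewrite mul0r subr0; exact/eqP.
by move=> g [_ ->]//; rewrite mul0r subr0.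
Qed.

Lemma rad_part_closed : Oq_closed Ux ry (rad_part Ux ry).
Proof.
have U0 : Ux 0 by exact: Ux0 hU.
apply: Oq_closed_relation => [f []//|f fO nRf].
apply: contrapT => h; apply: nRf; split => //; split; [apply/funext => z|move=> n].
  have [Uz|nUz] := pselect (Ux z); last exact: Oq_off fO nUz.
  apply: contrapT => fnz; apply: h; exists 0%N, z, z, 0; split => //.
    by rewrite mul0r subr0; exact/eqP.
  by move=> g [_ [-> _]]; rewrite mul0r subr0.
apply: contrapT => fn0; apply: h; exists n, 0, 0, 0; split => //.
  by rewrite mul0r subr0; exact/eqP.
by move=> g [_ [_ ->]]; rewrite mul0r subr0.
Qed.

Lemma Id_part_closed : Oq_closed Ux ry (Id_part Ux ry).
Proof.
have U0 : Ux 0 by exact: Ux0 hU.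
apply: Oq_closed_relation => [f []//|f fO nIf].
apply: contrapT => h; apply: nIf; apply: Id_part_intro => //; [apply/funext => z|move=> n z Uz].
  have [Uz|nUz] := pselect (Ux z); last exact: Oq_off fO nUz.
  apply: contrapT => fnz; apply: h; exists 0%N, z, z, 0; split => //.
    by rewrite mul0r subr0; exact/eqP.
  by move=> g [_ [-> _]]; rewrite mul0r subr0.
apply: contrapT => fn0; apply: h; exists n, z, 0, 1; split => //.
  by rewrite mul1r subr_eq0; exact/eqP.
by move=> g /Id_part_cst gc; rewrite mul1r gc// subrr.
Qed.

(** * Products inside the summands and commutators *)

Hypothesis hq1 : cabs q < 1.

Lemma OUx_part_subalgebra : subalgebra q Ux ry (OUx_part Ux ry).
Proof.
split.
- by move=> f [].
- by split=> [|n n0]; [exact: Oq_szero hU|].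
- move=> f g [fO hf] [gO hg]; split; first exact: Oq_sadd.
  by move=> n n0; apply/funext => z; rewrite /sadd hf// hg// addr0.
- move=> c f [fO hf]; split; first exact: Oq_sscale.
  by move=> n n0; apply/funext => z; rewrite /sscale hf// mulr0.
- move=> f g [fO hf] [gO hg]; split; first exact: Oq_smul.
  move=> n n0; apply/funext => z.
  have [Uz|nUz] := pselect (Ux z); last exact: smul_off.
  rewrite smulE// big1// => -[[|i] ni] _ /=; last by rewrite hf// mul0r.
  by rewrite subn0 hg// mulr0.
Qed.

(** The point [0] is fixed by z |-> q z, so every summand of a coefficient at [0] has a factor
    g_j(0) = 0. *)
Lemma rad_part_smull f g : Oq Ux ry f -> rad_part Ux ry g -> rad_part Ux ry (smul q Ux f g).
Proof.
move=> fO [gO [g0 g00]]; split; first exact: Oq_smul.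
split=> [|n]; last first.
  by rewrite smulE; [rewrite big1// => i _; rewrite mulr0 g00 mulr0|exact: Ux0 hU].
apply/funext => z; have [Uz|nUz] := pselect (Ux z); last exact: smul_off.
by rewrite smulE// big_ord1 subnn g0 mulr0.
Qed.

Lemma rad_part_subalgebra : subalgebra q Ux ry (rad_part Ux ry).
Proof.
split.
- by move=> f [].
- by split; [exact: Oq_szero hU|].
- move=> f g [fO [f0 hf]] [gO [g0 hg]]; split; first exact: Oq_sadd.
  split=> [|n]; first by apply/funext => z; rewrite /sadd f0 g0 addr0.
  by rewrite /sadd hf hg addr0.
- move=> c f [fO [f0 hf]]; split; first exact: Oq_sscale.
  split=> [|n]; first by apply/funext => z; rewrite /sscale f0 mulr0.
  by rewrite /sscale hf mulr0.
- by move=> f g [fO _] gR; exact: rad_part_smull.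
Qed.

Lemma Id_part_subalgebra : subalgebra q Ux ry (Id_part Ux ry).
Proof.
split.
- by move=> f [].
- by apply: Id_part_intro => //; exact: Oq_szero hU.
- move=> f g fI gI; have [fO [f0 _]] := fI; have [gO [g0 _]] := gI.
  apply: Id_part_intro => [||n z Uz]; first exact: Oq_sadd.
    by apply/funext => z; rewrite /sadd f0 g0 addr0.
  by rewrite /sadd (Id_part_cst _ fI)// (Id_part_cst _ gI).
- move=> c f fI; have [fO [f0 _]] := fI.
  apply: Id_part_intro => [||n z Uz]; first exact: Oq_sscale.
    by apply/funext => z; rewrite /sscale f0 mulr0.
  by rewrite /sscale (Id_part_cst _ fI).
- move=> f g fI gI; have [fO [f0 _]] := fI; have [gO [g0 _]] := gI.
  apply: Id_part_intro => [||n z Uz]; first exact: Oq_smul.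
    apply/funext => z; have [Uz|nUz] := pselect (Ux z); last exact: smul_off.
    by rewrite smulE// big_ord1 f0 mul0r.
  rewrite !smulE//; last exact: Ux0 hU.
  apply: eq_bigr => i _; rewrite (Id_part_cst _ fI)// (Id_part_cst _ gI) ?mulr0//.
  exact: UxM hU _ _ Uz.
Qed.

(** The twist disappears at [0], where coefficients multiply like commutative power series, and in
    degree 0, where the product is pointwise. *)
Lemma smul_commutator_rad f g : Oq Ux ry f -> Oq Ux ry g ->
  rad_part Ux ry (ssub (smul q Ux f g) (smul q Ux g f)).
Proof.
move=> fO gO; split; first by apply: Oq_ssub; exact: Oq_smul.
split=> [|n].
  apply/funext => z; rewrite /ssub.
  have [Uz|nUz] := pselect (Ux z); last by rewrite !smul_off// subr0.
  by rewrite !smulE// !big_ord1 expr0 mul1r mulrC subrr.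
rewrite /ssub !smulE; [|exact: Ux0 hU..].
rewrite [X in _ - X](reindex_inj rev_ord_inj) /= -sumrB big1// => i _.
by rewrite !mulr0 subSS subKn -1?ltnS// mulrC subrr.
Qed.

End Decomposition.

(** * Characters and the Jacobson radical *)

(** If all lower coefficients vanish, a_n t^n is minus the tail, which is at most B (t/rho)^(n+1).
    Hence |a_n| rho^(n+1) <= B t for all small [t], which forces a_n = 0. *)
Lemma power_series_zero (R : realType) (a : nat -> Cplx R) (rho B : R) : 0 < rho ->
  (forall N, \sum_(i < N) cabs (a i) * rho ^+ i <= B) ->
  (forall t : R, 0 < t < rho -> is_csum (fun n => a n * (t%:C%C : Cplx R) ^+ n) 0) ->
  forall n, a n = 0.
Proof.
move=> rho0 aB a0; elim/ltn_ind => n IH.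
have B0 : 0 <= B by apply: le_trans (aB 0%N); rewrite big_ord0.
have key t : 0 < t < rho -> cabs (a n) * rho ^+ n.+1 <= B * t.
  move=> /[dup] t01 /andP[t0 t1].
  have tn : 0 < t ^+ n by exact: exprn_gt0.
  have rn : 0 < rho ^+ n.+1 by exact: exprn_gt0.
  suff : cabs (a n) * t ^+ n <= B * (t / rho) ^+ n.+1.
    rewrite expr_div_n mulrA ler_pdivlMr// [t ^+ n.+1]exprS.
    rewrite (_ : B * (t * t ^+ n) = B * t * t ^+ n); last by ring.
    rewrite (_ : _ * t ^+ n * _ = cabs (a n) * rho ^+ n.+1 * t ^+ n); last by ring.
    by rewrite ler_pM2r.
  apply/ler_addgt0Pr => e e0; have [N h] := a0 t t01 _ e0.
  have := h (n.+1 + N)%N (leq_addl _ _); rewrite sub0r cabsN big_split_ord /=.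
  rewrite big_ord_recr /= big1 ?add0r; last by move=> i _; rewrite IH ?mul0r.
  set T := \sum_(i < N) _.
  have TB : cabs T <= B * (t / rho) ^+ n.+1.
    apply: le_trans (cabs_sum _ _ _) _.
    apply: (@le_trans _ _ (\sum_(i < N) cabs (a (n.+1 + i)%N) * rho ^+ (n.+1 + i) * (t / rho) ^+ n.+1)).
      apply: ler_sum => i _; rewrite cabsM cabsX cabs_real (gtr0_norm t0) -mulrA.
      apply: ler_wpM2l; first exact: cabs_ge0.
      rewrite expr_div_n !exprD [leRHS]mulrC mulrA divfK ?gt_eqF//.
      apply: ler_wpM2l; first by rewrite exprn_ge0// ltW.
      by rewrite lerXn2r// ?nnegrE ltW.
    rewrite -mulr_suml; apply: ler_wpM2r.
      by rewrite exprn_ge0// divr_ge0// ltW.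
    apply: le_trans (aB (n.+1 + N)%N); rewrite big_split_ord /= lerDr.
    by apply: sumr_ge0 => i _; rewrite mulr_ge0 ?cabs_ge0 ?exprn_ge0// ltW.
  have := le_cabsBl _ (a n * (t%:C)%C ^+ n) (- T).
  rewrite opprK cabsN cabsM cabsX cabs_real (gtr0_norm t0); lra.
apply/eqP/contraT => an; have c0 := cabs_gt0 _ _ an.
have x0 : 0 < cabs (a n) * rho ^+ n.+1 by rewrite mulr_gt0// exprn_gt0.
have B1 : 0 < B + 1 by lra.
set x := cabs (a n) * rho ^+ n.+1 in key x0 *.
(* For this [t], x <= B t < (B + 1) t <= x is a contradiction; B + 1 keeps the divisor positive when
   B = 0. *)
pose t := Num.min (rho / 2) (x / (B + 1)).
have t0 : 0 < t by rewrite lt_min !divr_gt0.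
have tr : t < rho by apply: (@le_lt_trans _ _ (rho / 2)); [rewrite ge_min lexx|lra].
have tx : t * (B + 1) <= x by rewrite -ler_pdivlMr// ge_min lexx orbT.
have := key t; rewrite t0 tr => /(_ isT); nra.
Qed.

Section Characters.
Variables (R : realType) (q : Cplx R) (Ux : set (Cplx R)) (ry : \bar R).
Hypotheses (hq1 : cabs q < 1) (hU : qd_open q Ux ry).
Implicit Types (f g : qseries R) (l : qseries R -> Cplx R).

Lemma eq_mono N (g h : Cplx R -> Cplx R) : (forall z, Ux z -> g z = h z) ->
  mono Ux N g = mono Ux N h.
Proof.
move=> gh; apply/funext => n; apply/funext => z.
have [Uz|nUz] := pselect (Ux z); last by rewrite !mono_off.
by rewrite !monoE// gh.
Qed.

Lemma character_sone l : character q Ux ry l -> l (sone Ux) = 1.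
Proof.
move=> [_ _ lM [f [fO lf]]].
have := lM _ _ (Oq_sone _ _ _ _ hU) fO; rewrite (smul1l _ _ _ ry)// => h.
by apply: (mulIf (introN eqP lf)); rewrite mul1r -h.
Qed.

Lemma character_cst l (c : Cplx R) : character q Ux ry l -> l (mono Ux 0 (fun _ => c)) = c.
Proof.
move=> hl; have [_ lZ _ _] := hl.
have -> : mono Ux 0 (fun _ => c) = sscale c (sone Ux).
  apply/funext => n; apply/funext => z; rewrite /mono /sscale /sone.
  by case: ifP; rewrite ?mulr0 ?mulr1.
by rewrite lZ ?(character_sone _ hl) ?mulr1//; exact: Oq_sone hU.
Qed.

Lemma character_szero l : character q Ux ry l -> l (@szero R) = 0.
Proof.
move=> [_ lZ _ _]; have -> : @szero R = sscale 0 (@szero R).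
  by apply/funext => n; apply/funext => z; rewrite /sscale mul0r.
by rewrite lZ ?mul0r//; exact: Oq_szero hU.
Qed.

Lemma character_ssub l f g : character q Ux ry l -> Oq Ux ry f -> Oq Ux ry g ->
  l (ssub f g) = l f - l g.
Proof.
move=> [lD lZ _ _] fO gO; rewrite ssubE lD//; last exact: Oq_sscale.
by rewrite lZ// mulN1r.
Qed.

(** If l(f) is nonzero, 1 - f / l(f) lies in the kernel, so a left ideal containing both the kernel
    and [f] contains 1. *)
Lemma character_kernel_maximal l : character q Ux ry l ->
  maximal_left_ideal q Ux ry [set f | Oq Ux ry f /\ l f = 0].
Proof.
move=> hl; have [lD lZ lM _] := hl.
split; [split| |].
- by move=> f [].
- by split; [exact: Oq_szero hU|exact: character_szero].
- move=> a b [aO la] [bO lb]; split; first exact: Oq_sadd.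
  by rewrite lD// la lb addr0.
- move=> r a rO [aO la]; split; first exact: Oq_smul.
  by rewrite lM// la mulr0.
- by move=> [_]; rewrite character_sone//; apply/eqP; exact: oner_neq0.
move=> L' [L'O L'0 L'D L'M] LL' L'1 f L'f; have fO := L'O _ L'f.
split => //; apply: contrapT => lf; apply: L'1.
have sO : Oq Ux ry (sscale (l f)^-1 f) by exact: Oq_sscale.
have -> : sone Ux = sadd (ssub (sone Ux) (sscale (l f)^-1 f)) (sscale (l f)^-1 f).
  by apply/funext => n; apply/funext => z; rewrite /sadd /ssub subrK.
apply: (L'D _ _ _ _); last first.
  (* Left ideals are defined by closure under products, so the scalar is read as a constant
     series. *)
  rewrite (sscaleE _ q Ux ry)//; apply: L'M => //.
  by apply: (Oq_mono _ _ _ _ hU); exact: holomorphic_cst.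
apply: LL'; split; first by apply: Oq_ssub => //; exact: Oq_sone hU.
rewrite (character_ssub _ _ _ hl)//; last exact: Oq_sone hU.
by rewrite character_sone// lZ// mulVf ?subrr//; exact/eqP.
Qed.

Lemma in_Spec_horizontal z : Ux z -> in_Spec q Ux ry (fun f => f 0%N z).
Proof.
move=> Uz; split.
  split=> [//|//|f g _ _|].
    by rewrite smulE// big_ord1 expr0 mul1r.
  exists (sone Ux); split; first exact: Oq_sone hU.
  by rewrite /sone mem_set//; apply/eqP; exact: oner_neq0.
move=> f fO eps eps0.
have [||rho a] := adm_finite _ _ _ _ hU [set z]; first exact: finite_set1.
  by move=> _ ->.
have [_ _ rho0 _] := a.
exists 1%N, (fun _ => [set z]), (fun _ => rho), eps; split => // g gO /(_ 0%N isT) gf.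
by have := pKr_coef_lt _ _ _ _ _ 0%N z rho0 gf erefl; rewrite expr0 mulr1.
Qed.

(** The default [0] is returned only when the series diverges, which does not happen for [b] in the
    disc and [f] in the algebra. *)
Definition vertical_value (b : Cplx R) f : Cplx R :=
  xget 0 [set s | is_csum (fun n => f n 0 * b ^+ n) s].

Lemma vertical_majorant (b : Cplx R) (rho : R) f d : cabs b <= rho ->
  majorant [set 0] rho f d -> forall n, cabs (f n 0 * b ^+ n) <= d n.
Proof.
move=> br [d0 fd] n; apply: le_trans (fd n 0 erefl); rewrite cabsM cabsX.
by apply: ler_wpM2l; [exact: cabs_ge0|rewrite lerXn2r ?nnegrE ?(le_trans (cabs_ge0 _ b))].
Qed.

Lemma adm_vertical (b : Cplx R) : disc ry b ->
  exists2 rho, cabs b <= rho & adm Ux ry [set 0] rho.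
Proof.
move=> /radius_between[rho br rhoy]; exists rho; first exact: ltW.
split => //; [exact/finite_compact/finite_set1|by move=> _ ->; exact: Ux0 hU|].
exact: le_lt_trans (cabs_ge0 _ b) br.
Qed.

Lemma vertical_summable (b : Cplx R) f : disc ry b -> Oq Ux ry f ->
  abs_summable (fun n => f n 0 * b ^+ n).
Proof.
move=> /adm_vertical[rho br a] fO.
have [d [B [fd dB]]] := Oq_majorant _ _ _ _ _ _ fO a.
exists B => N; apply: le_trans (dB N); apply: ler_sum => i _.
exact: (vertical_majorant _ _ _ _ br fd).
Qed.

Lemma vertical_valueP (b : Cplx R) f : disc ry b -> Oq Ux ry f ->
  is_csum (fun n => f n 0 * b ^+ n) (vertical_value b f).
Proof.
move=> bd fO; have [s hs] := abs_summable_is_csum _ _ (vertical_summable _ _ bd fO).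
exact: (xgetPex 0 (ex_intro _ s hs)).
Qed.

Lemma vertical_valueE (b : Cplx R) f s : disc ry b -> Oq Ux ry f ->
  is_csum (fun n => f n 0 * b ^+ n) s -> vertical_value b f = s.
Proof. by move=> bd fO; apply: is_csum_unique; exact: vertical_valueP. Qed.

Lemma vertical_mono (b : Cplx R) N (g : Cplx R -> Cplx R) : disc ry b ->
  holomorphic_on Ux g -> vertical_value b (mono Ux N g) = g 0 * b ^+ N.
Proof.
move=> bd hg; apply: (vertical_valueE _ _ _ bd (Oq_mono _ _ _ _ hU _ _ hg)) => e e0.
 exists N.+1 => m Nm.
have -> : \sum_(i < m) mono Ux N g i 0 * b ^+ i = g 0 * b ^+ N.
  rewrite (bigD1 (Ordinal Nm))//= big1 ?addr0.
    by rewrite monoE ?eqxx//; exact: Ux0 hU.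
  move=> i iN; rewrite monoE; last exact: Ux0 hU.
  by rewrite (_ : (i == N :> nat) = false) ?mul0r//; exact/negbTE.
by rewrite subrr cabs0 ltW.
Qed.

(** At z = 0 the twisted product is the ordinary Cauchy product, whence multiplicativity. For |b| <=
    rho < r_y the seminorm for the compact set {0} and the radius [rho] dominates the functional,
    whence continuity. *)
Lemma in_Spec_vertical (b : Cplx R) : disc ry b -> in_Spec q Ux ry (vertical_value b).
Proof.
move=> bd; have vP := vertical_valueP _ _ bd.
have lD f g : Oq Ux ry f -> Oq Ux ry g ->
    vertical_value b (sadd f g) = vertical_value b f + vertical_value b g.
  move=> fO gO; apply: (vertical_valueE _ _ _ bd (Oq_sadd _ _ _ _ _ fO gO)).
  under eq_fun do rewrite /sadd mulrDl.
  exact: is_csumD (vP _ fO) (vP _ gO).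
have lZ c f : Oq Ux ry f -> vertical_value b (sscale c f) = c * vertical_value b f.
  move=> fO; apply: (vertical_valueE _ _ _ bd (Oq_sscale _ _ _ c _ fO)).
  under eq_fun do rewrite /sscale -mulrA.
  exact: is_csumZ (vP _ fO).
split.
  split => //.
    move=> f g fO gO.
    apply: (vertical_valueE _ _ _ bd (Oq_smul _ _ _ _ hq1 hU _ _ fO gO)).
    have := is_csum_cauchy_product _ _ _ _ _ (vertical_summable _ _ bd fO)
      (vertical_summable _ _ bd gO) (vP _ fO) (vP _ gO).
    congr is_csum; apply/funext => n; rewrite smulE; last exact: Ux0 hU.
    rewrite mulr_suml; apply: eq_bigr => i _; rewrite mulr0.
    by rewrite mulrACA -exprD subnKC// leq_ord.
  exists (sone Ux); split; first exact: Oq_sone hU.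
  rewrite [vertical_value _ _](_ : _ = 1); last first.
    by have := vertical_mono b 0%N (fun _ => 1) bd (@holomorphic_cst _ Ux 1); rewrite mul1r expr0.
  by apply/eqP; exact: oner_neq0.
move=> f fO eps eps0; have [rho br a] := adm_vertical _ bd; have [_ _ rho0 _] := a.
exists 1%N, (fun _ => [set 0]), (fun _ => rho), eps; split => //.
move=> g gO /(_ 0%N isT)/(pKr_ltP _ _ _ _ _ rho0)[d [B [fd dB Be]]].
apply: le_lt_trans Be.
rewrite (_ : _ - _ = vertical_value b (ssub g f)); last first.
  by rewrite ssubE lD ?lZ ?mulN1r//; exact: Oq_sscale.
apply: is_csum_le (vP _ (Oq_ssub _ _ _ _ _ gO fO)) _ => N.
apply: le_trans (dB N); apply: ler_sum => i _.
exact: (vertical_majorant _ _ _ _ br fd).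
Qed.

Lemma jacobson_rad_sub : jacobson_rad q Ux ry `<=` rad_part Ux ry.
Proof.
move=> a [aO aL].
have la l : in_Spec q Ux ry l -> l a = 0.
  by move=> [hl _]; have [] := aL _ (character_kernel_maximal _ hl).
split => //; split.
  apply/funext => z; have [Uz|nUz] := pselect (Ux z); last exact: Oq_off aO nUz.
  exact: la (in_Spec_horizontal _ Uz).
have [||rho adm0] := adm_finite _ _ _ _ hU [set 0]; first exact: finite_set1.
  by move=> _ ->; exact: Ux0 hU.
have [_ _ rho0 rhoy] := adm0.
have [d [B [fd dB]]] := Oq_majorant _ _ _ _ _ _ aO adm0.
(* The vertical characters at real points 0 < t < rho already determine all the a_n(0). *)
apply: (power_series_zero _ (fun n => a n 0) rho B rho0) => [N|t /andP[t0 tr]].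
  by apply: le_trans (dB N); apply: ler_sum => i _; case: fd => _; apply.
have td : disc ry (t%:C%C : Cplx R).
  by rewrite /disc /= cabs_real gtr0_norm// (lt_trans _ rhoy)// lte_fin.
by have := vertical_valueP _ _ td aO; rewrite (la _ (in_Spec_vertical _ td)).
Qed.

(** If a maximal left ideal [L] misses [a], adding the left multiples of [a] to it yields 1 = l + r
    a with [l] in [L]. Since r a again has vanishing coefficients at [0], l = 1 - r a has a left
    inverse, and [L] would contain 1. *)
Lemma rad_part_sub_jacobson : rad_part Ux ry `<=` jacobson_rad q Ux ry.
Proof.
move=> a aR; have [aO _] := aR; split => // L [[LO L0 LD LM] L1 Lmax].
apply: contrapT => nLa.
pose L' := [set f | exists b r, [/\ L b, Oq Ux ry r & f = sadd b (smul q Ux r a)]].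
have s0 f : Oq Ux ry f -> sadd f (@szero R) = f.
  by move=> _; apply/funext => n; apply/funext => z; rewrite /sadd addr0.
have zO := Oq_szero _ _ _ _ hU.
have z0 f : smul q Ux (@szero R) f = @szero R.
  apply/funext => n; apply/funext => z.
  have [Uz|nUz] := pselect (Ux z); last exact: smul_off.
  by rewrite smulE// big1// => i _; rewrite mul0r.
have L'I : left_ideal q Ux ry L'.
  split.
  - by move=> _ [l [r [/LO lO rO ->]]]; apply: Oq_sadd => //; exact: Oq_smul.
  - by exists (@szero R), (@szero R); rewrite z0 s0.
  - move=> _ _ [l [r [Ll rO ->]]] [l' [r' [Ll' rO' ->]]].
    exists (sadd l l'), (sadd r r'); split; [exact: LD|exact: Oq_sadd|].
    rewrite smulDl; apply/funext => n; apply/funext => z.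
    by rewrite /sadd addrACA.
  - move=> s _ sO [l [r [Ll rO ->]]]; exists (smul q Ux s l), (smul q Ux s r).
    split; [exact: LM|exact: Oq_smul|].
    by rewrite smulDr (smulA _ _ _ _ hU).
have LL' : L `<=` L'.
  by move=> f Lf; exists f, (@szero R); split => //; rewrite z0 s0//; exact: LO.
have [[l [r [Ll rO E]]]|nL'1] := pselect (L' (sone Ux)); last first.
  apply: nLa; apply: (Lmax L' L'I LL' nL'1); exists (@szero R), (sone Ux).
  split => //; first exact: Oq_sone hU.
  by rewrite (smul1l _ _ _ ry)//; apply/funext => n; apply/funext => z; rewrite /sadd add0r.
have raR := rad_part_smull _ _ _ _ hU hq1 _ _ rO aR.
have El : ssub (sone Ux) (smul q Ux r a) = l.
  by rewrite E; apply/funext => n; apply/funext => z; rewrite /ssub /sadd addrK.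
apply: L1; rewrite -(smul_quasi_inverse _ _ _ _ hU _ raR) El; apply: LM => //.
exact: Oq_quasi_inverse.
Qed.

Lemma jacobson_radE : jacobson_rad q Ux ry = rad_part Ux ry.
Proof. by apply/seteqP; split; [exact: jacobson_rad_sub|exact: rad_part_sub_jacobson]. Qed.

End Characters.
Arguments vertical_value {R} b f.

(** * The spectrum *)

Lemma uniform_threshold (P : nat -> nat -> Prop) m :
  (forall i, (i < m)%N -> exists N0, forall N, (N0 <= N)%N -> P i N) ->
  exists N0, forall i N, (i < m)%N -> (N0 <= N)%N -> P i N.
Proof.
elim: m => [|m IH] h; first by exists 0%N.
have [|N1 h1] := IH; first by move=> i im; apply: h; exact: ltnW.
have [N2 h2] := h m (ltnSn m).
exists (maxn N1 N2) => i N; rewrite ltnS leq_eqVlt geq_max => /orP[/eqP ->|im] /andP[? ?].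
  exact: h2.
exact: h1.
Qed.

Section Spectrum.
Variables (R : realType) (q : Cplx R) (Ux : set (Cplx R)) (ry : \bar R).
Hypotheses (hq1 : cabs q < 1) (hU : qd_open q Ux ry).
Implicit Types (f : qseries R) (l : qseries R -> Cplx R) (g h : Cplx R -> Cplx R).

(** Sequential continuity at [0]: a basic neighbourhood involves finitely many seminorms, so a
    common threshold exists. *)
Lemma spec_null_sequence l (u : nat -> qseries R) : in_Spec q Ux ry l ->
  (forall N, Oq Ux ry (u N)) ->
  (forall K rho, adm Ux ry K rho -> forall e : R, 0 < e ->
     exists N0, forall N, (N0 <= N)%N -> (pKr K rho (u N) < e%:E)%E) ->
  forall e : R, 0 < e -> exists N0, forall N, (N0 <= N)%N -> cabs (l (u N)) < e.
Proof.
move=> [hl cl] uO u0 e e0.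
have [m [Ks [rhos [delta [[aK delta0] hd]]]]] := cl _ (Oq_szero _ _ _ _ hU) e e0.
have [|N0 hN0] := uniform_threshold (fun i N => (pKr (Ks i) (rhos i) (u N) < delta%:E)%E) m.
  by move=> i im; apply: u0 => //; exact: aK.
exists N0 => N N0N; have := hd (u N) (uO N); rewrite (character_szero _ _ _ _ hU _ hl) subr0; apply.
move=> i im; rewrite (_ : ssub _ _ = u N); first exact: hN0.
by apply/funext => n; apply/funext => z; rewrite /ssub subr0.
Qed.

Section OneCharacter.
Variable l : qseries R -> Cplx R.
Hypothesis lS : in_Spec q Ux ry l.

Let hl : character q Ux ry l. Proof. by case: lS. Qed.
Let l0 g := l (mono Ux 0 g).

Let l0M g h : holomorphic_on Ux g -> holomorphic_on Ux h ->
  l0 (fun z => g z * h z) = l0 g * l0 h.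
Proof.
move=> hg hh; have [_ _ lM _] := hl.
rewrite /l0 -lM; [|exact: (Oq_mono _ _ _ _ hU)..].
rewrite (smul_mono _ _ _ _ hU); congr l; apply: eq_mono => z _.
by rewrite expr0 mul1r.
Qed.

Let l0Bcst g (c : Cplx R) : holomorphic_on Ux g -> l0 (fun z => g z - c) = l0 g - c.
Proof.
move=> hg; rewrite /l0 -[X in _ - X](character_cst _ _ _ _ hU _ c hl).
rewrite -(character_ssub _ _ _ _ _ _ _ hl); last 2 first.
- exact: (Oq_mono _ _ _ _ hU).
- by apply: (Oq_mono _ _ _ _ hU); exact: holomorphic_cst.
congr l; apply/funext => n; apply/funext => z; rewrite /ssub /mono.
by case: ifP => // _; rewrite subr0.
Qed.

Let hB (c : Cplx R) : holomorphic_on Ux (fun z => z - c).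
Proof.
apply: (holomorphicD _ _ _ (fun _ => - c)); [exact: holomorphic_id|exact: holomorphic_cst].
Qed.

Let l0Bx : l0 (fun z => z - l (sx Ux)) = 0.
Proof.
by rewrite (l0Bcst (fun z => z)); [exact: subrr|exact: holomorphic_id].
Qed.

(** Outside [Ux], the number a = l(x) would make x - a invertible among the holomorphic functions,
    while [l] sends x - a to [0]. *)
Lemma spec_x_mem : Ux (l (sx Ux)).
Proof.
apply: contrapT => nUa; set a := l (sx Ux) in nUa.
have ne z : Ux z -> z - a != 0.
  by move=> Uz; rewrite subr_eq0; apply/eqP => za; rewrite za in Uz.
have := l0M _ _ (hB a) (holomorphicV _ _ _ (hB a) ne).
rewrite l0Bx mul0r => h.
have : l0 (fun _ => 1) = 0.
  by rewrite -h; congr l; apply: eq_mono => z Uz; rewrite mulfV// ne.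
by rewrite /l0 (character_cst _ _ _ _ hU _ 1 hl); apply/eqP; exact: oner_neq0.
Qed.

(* Dividing the square of [g - g a] by [x - a] gives a function that is visibly holomorphic
   at [a], which avoids the removable singularity theorem. *)
Lemma spec_coef g : holomorphic_on Ux g -> l (mono Ux 0 g) = g (l (sx Ux)).
Proof.
move=> hg; set a := l (sx Ux).
have hgB : holomorphic_on Ux (fun z => g z - g a).
  by apply: (holomorphicD _ _ _ (fun _ => - g a)); [exact: hg|exact: holomorphic_cst].
have := l0M _ _ (holomorphic_sqr_quotient _ _ _ a (open_Ux _ _ _ _ hU) hg) (hB a).
rewrite l0Bx mulr0 => h.
have := l0M _ _ hgB hgB.
rewrite (_ : l0 _ = 0); last first.
  rewrite -h; congr l; apply: eq_mono => z Uz; rewrite -expr2.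
  have [->|za] := eqVneq z a; first by rewrite !subrr expr0n mulr0.
  by rewrite divfK// subr_eq0.
rewrite l0Bcst// => /esym/eqP; rewrite mulf_eq0 orbb subr_eq0 => /eqP //.
Qed.

Lemma spec_mono N g : holomorphic_on Ux g ->
  l (mono Ux N g) = g (l (sx Ux)) * l (sy Ux) ^+ N.
Proof.
move=> hg; have [_ _ lM _] := hl.
have h1 := @holomorphic_cst _ Ux 1.
have -> : mono Ux N g = smul q Ux (mono Ux 0 g) (mono Ux N (fun _ => 1)).
  by rewrite (smul_mono _ _ _ _ hU); apply: eq_mono => z _; rewrite mulr1.
rewrite lM; [|exact: (Oq_mono _ _ _ _ hU)..].
rewrite spec_coef//; congr (_ * _).
elim: N => [|N IH]; first by rewrite expr0; exact: (character_cst _ _ _ _ hU _ 1 hl).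
have -> : mono Ux N.+1 (fun _ => 1) = smul q Ux (mono Ux N (fun _ => 1)) (sy Ux).
  rewrite (smul_mono _ _ _ _ hU (fun _ => 1) (fun _ => 1) N 1%N) addn1.
  by apply: eq_mono => z _; rewrite mulr1.
rewrite lM; [by rewrite IH exprSr|exact: (Oq_mono _ _ _ _ hU _ _ h1)|exact: Oq_sy hU].
Qed.

Lemma spec_xy0 : l (sx Ux) * l (sy Ux) = 0.
Proof.
have [_ lZ lM _] := hl; have xO := Oq_sx _ _ _ _ hU; have yO := Oq_sy _ _ _ _ hU.
have E : smul q Ux (sy Ux) (sx Ux) = sscale q (smul q Ux (sx Ux) (sy Ux)).
  rewrite (smul_mono _ _ _ _ hU (fun _ => 1) (fun z => z) 1%N 0%N).
  rewrite (smul_mono _ _ _ _ hU (fun z => z) (fun _ => 1) 0%N 1%N).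
  apply/funext => n; apply/funext => z; rewrite /mono /sscale.
  by case: ifP => _; rewrite ?mulr0// mul1r mulr1.
have := congr1 l E; rewrite lZ; last exact: Oq_smul.
rewrite !lM//.
rewrite [l (sy Ux) * _]mulrC => /eqP; rewrite -subr_eq0 -[X in X - _]mul1r -mulrBl.
rewrite mulf_eq0 subr_eq0 => /orP[/eqP q1|/eqP //].
by move: hq1; rewrite -q1 cabs1 ltxx.
Qed.

(** If b = l(y) had |b| >= r_y, the series b^(-N) y^N would tend to zero like (rho/|b|)^N in every
    seminorm, although [l] takes the value 1 on each. *)
Lemma spec_y_mem : disc ry (l (sy Ux)).
Proof.
rewrite /disc /=; set b := l (sy Ux); rewrite ltNge; apply/negP => ryb.
have b0 : b != 0.
  apply/eqP => b0; move: ryb; rewrite b0 cabs0 leNgt; apply/negP/negPn.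
  by case: hU.
have h1 := @holomorphic_cst _ Ux 1.
have mO N : Oq Ux ry (mono Ux N (fun _ => 1)) by exact: (Oq_mono _ _ _ _ hU).
pose u N := sscale (b ^- N) (mono Ux N (fun _ => 1)).
have lu N : l (u N) = 1.
  have [_ lZ _ _] := hl; rewrite (lZ _ _ (mO N)) (spec_mono _ _ h1) mul1r mulVf//.
  by rewrite expf_neq0.
have c0 := cabs_gt0 _ _ b0.
have uO N : Oq Ux ry (u N) by exact: Oq_sscale.
suff u0 K rho : adm Ux ry K rho -> forall e : R, 0 < e ->
    exists N0, forall N, (N0 <= N)%N -> (pKr K rho (u N) < e%:E)%E.
  have [N /(_ N (leqnn N))] := spec_null_sequence _ u lS uO u0 _ ltr01.
  by rewrite lu cabs1 ltxx.
move=> [cK KU rho0 rhoy] e e0.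
have rb : rho < cabs b by rewrite -lte_fin; exact: lt_le_trans rhoy ryb.
have r0 : 0 <= rho / cabs b by rewrite divr_ge0// ltW.
have r1 : rho / cabs b < 1 by rewrite ltr_pdivrMr// mul1r.
have [N0 hN0] := geometric_small _ _ _ r0 r1 e0.
exists N0 => N /hN0; rewrite expr_div_n => lte; apply/pKr_ltP => //.
have bN0 : 0 <= cabs b ^- N by rewrite invr_ge0 exprn_ge0// ltW.
have bN z : K z -> cabs (b ^- N) <= cabs b ^- N by move=> _; rewrite cabsV cabsX.
have [d fd dB] := mono_majorant _ Ux N (fun _ => b ^- N) K rho _ rho0 bN0 bN.
exists d, (cabs b ^- N * rho ^+ N); split; [|exact: dB|by rewrite mulrC].
rewrite (_ : u N = mono Ux N (fun _ => b ^- N))//.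
apply/funext => n; apply/funext => z; rewrite /u /sscale /mono.
by case: ifP => _; rewrite ?mulr0 ?mulr1.
Qed.

Lemma spec_Ucxy : Ucxy Ux ry (l (sx Ux), l (sy Ux)).
Proof.
have /eqP := spec_xy0; rewrite mulf_eq0 => /orP[/eqP x0|/eqP y0]; [right|left] => /=.
  by split => //; exact: spec_y_mem.
by split => //; exact: spec_x_mem.
Qed.

End OneCharacter.

(** * Tails of series and uniqueness of characters *)

Definition tail (N : nat) f : qseries R := fun n z => if (n < N)%N then 0 else f n z.

Lemma Oq_tail N f : Oq Ux ry f -> Oq Ux ry (tail N f).
Proof.
move=> fO; apply: (Oq_dominated _ _ _ _ _ fO) => [n|n z nz|n z Uz]; rewrite /tail.
- by case: (n < N)%N; [exact: holomorphic_cst|exact: Oq_hol fO].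
- by rewrite (Oq_off _ _ _ _ _ _ fO nz) if_same.
- by case: ifP => // _; rewrite cabs0 cabs_ge0.
Qed.

Lemma tailS N f : Oq Ux ry f -> tail N f = sadd (mono Ux N (f N)) (tail N.+1 f).
Proof.
move=> fO; apply/funext => n; apply/funext => z; rewrite /tail /sadd.
have [Uz|nUz] := pselect (Ux z); last first.
  by rewrite (Oq_off _ _ _ _ _ _ fO nUz) mono_off// !if_same addr0.
rewrite monoE// ltnS [(n <= N)%N]leq_eqVlt; case: eqP => [->|_] /=; first by rewrite ltnn addr0.
by rewrite add0r.
Qed.

Lemma tail_null f K rho : Oq Ux ry f -> adm Ux ry K rho -> forall e : R, 0 < e ->
  exists N0, forall N, (N0 <= N)%N -> (pKr K rho (tail N f) < e%:E)%E.
Proof.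
move=> fO a e e0; have [_ _ rho0 _] := a.
have [d [B [[d0 fd] dB]]] := Oq_majorant _ _ _ _ _ _ fO a.
have e2 : 0 < e / 2 by lra.
have [N0 hN0] := bounded_series_tail _ d B d0 dB _ e2.
exists N0 => N N0N; apply/pKr_ltP => //.
pose d' n := if (n < N)%N then 0 else d n.
exists d', (e / 2); split; last by lra.
  split=> [n|n z Kz]; rewrite /d'; first by case: ifP.
  by rewrite /tail; case: ifP => _; rewrite ?cabs0 ?mul0r// fd.
move=> M; apply: (@le_trans _ _ (\sum_(i < N + M) d' i)).
  by apply: ler_sum_widen; [move=> i; rewrite /d'; case: ifP|exact: leq_addl].
have := hN0 (N + M)%N; have := ler_sum_widen _ d _ _ d0 N0N; rewrite !big_split_ord /=.
have -> : \sum_(i < N) d' i = 0 by apply: big1 => i _; rewrite /d' ltn_ord.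
have -> : \sum_(i < M) d' (N + i)%N = \sum_(i < M) d (N + i)%N.
  by apply: eq_bigr => i _; rewrite /d' ltnNge leq_addr.
lra.
Qed.

(** The two characters agree on every monomial, so their difference on [f] equals that on any tail
    of [f]; the tails tend to zero in every seminorm. *)
Lemma spec_unique l l' : in_Spec q Ux ry l -> in_Spec q Ux ry l' ->
  l (sx Ux) = l' (sx Ux) -> l (sy Ux) = l' (sy Ux) -> forall f, Oq Ux ry f -> l f = l' f.
Proof.
move=> lS lS' ex ey f fO; have [[lD _ _ _] _] := lS; have [[lD' _ _ _] _] := lS'.
have step N : l f - l' f = l (tail N f) - l' (tail N f).
  elim: N => [|N ->]; first by [].
  have mO : Oq Ux ry (mono Ux N (f N)).
    by apply: (Oq_mono _ _ _ _ hU); exact: Oq_hol fO.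
  have tO := Oq_tail N.+1 _ fO; have fh := Oq_hol _ _ _ _ N fO.
  rewrite (tailS _ _ fO) (lD _ _ mO tO) (lD' _ _ mO tO).
  rewrite (spec_mono _ lS _ _ fh) (spec_mono _ lS' _ _ fh).
  by rewrite ex ey; ring.
apply: subr0_eq; apply: cabs_le0 => e e0.
have e2 : 0 < e / 2 by lra.
have tO N : Oq Ux ry (tail N f) by exact: Oq_tail.
have t0 K rho := tail_null _ K rho fO.
have [N1 h1] := spec_null_sequence _ _ lS tO t0 _ e2.
have [N2 h2] := spec_null_sequence _ _ lS' tO t0 _ e2.
rewrite (step (maxn N1 N2)); apply: le_trans (le_cabsD _ _ _) _; rewrite cabsN.
by have := h1 _ (leq_maxl N1 N2); have := h2 _ (leq_maxr N1 N2); lra.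
Qed.

End Spectrum.

Theorem theorem5p1 (R : realType) (q : Cplx R) (Ux : set (Cplx R)) (ry : \bar R)
  (hq0 : 0 < cabs q) (hq1 : cabs q < 1) (hU : qd_open q Ux ry) :
  let O := Oq Ux ry in
  let A := OUx_part Ux ry in
  let Rad := jacobson_rad q Ux ry in
  let I := Id_part Ux ry in
  (* the Jacobson radical is the explicit set *)
  Rad = rad_part Ux ry /\
  (* the three pieces are closed subalgebras *)
  (subalgebra q Ux ry A /\ subalgebra q Ux ry Rad /\ subalgebra q Ux ry I) /\
  (Oq_closed Ux ry A /\ Oq_closed Ux ry Rad /\ Oq_closed Ux ry I) /\
  (* O_q(U) = A (+) Rad (+) I as a topological direct sum *)
  (exists pA pR pI : qseries R -> qseries R,
     (forall f, O f -> [/\ A (pA f), Rad (pR f), I (pI f)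
                         & f = sadd (pA f) (sadd (pR f) (pI f))]) /\
     Oq_continuous Ux ry pA /\ Oq_continuous Ux ry pR /\ Oq_continuous Ux ry pI) /\
  (forall a r i a' r' i', A a -> Rad r -> I i -> A a' -> Rad r' -> I i' ->
     sadd a (sadd r i) = sadd a' (sadd r' i') -> [/\ a = a', r = r' & i = i']) /\
  (* commutative modulo the Jacobson radical *)
  (forall f g, O f -> O g -> Rad (ssub (smul q Ux f g) (smul q Ux g f))) /\
  (* l |-> (l(x), l(y)) is a bijection Spec O_q(U) -> U *)
  (forall l, in_Spec q Ux ry l -> Ucxy Ux ry (l (sx Ux), l (sy Ux))) /\
  (forall ab, Ucxy Ux ry ab -> exists l, in_Spec q Ux ry l /\ (l (sx Ux), l (sy Ux)) = ab) /\
  (forall l l', in_Spec q Ux ry l -> in_Spec q Ux ry l' ->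
     l (sx Ux) = l' (sx Ux) -> l (sy Ux) = l' (sy Ux) -> forall f, O f -> l f = l' f).
Proof.
move=> O A Rad I; have RadE : Rad = rad_part Ux ry by exact: jacobson_radE.
rewrite RadE; split; first by [].
split; first by split; [exact: OUx_part_subalgebra|split; [exact: rad_part_subalgebra|exact: Id_part_subalgebra]].
split; first by split; [exact: (OUx_part_closed _ _ _ _ hU)|split; [exact: (rad_part_closed _ _ _ _ hU)|exact: (Id_part_closed _ _ _ _ hU)]].
split.
  exists (@projA R), (@projR R Ux), (@projI R Ux); split; last first.
    by split; [|split]; [exact: (projA_continuous _ _ _ _ hU)|exact: (projR_continuous _ _ _ _ hU)|exact: (projI_continuous _ _ _ _ hU)].
  move=> f fO; split; [exact: projA_part|exact: (projR_part _ _ _ _ hU)|exact: (projI_part _ _ _ _ hU)|exact: (proj_sum _ Ux ry)].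
split; first exact: (decomposition_unique _ _ _ _ hU).
split; first exact: smul_commutator_rad.
split; first exact: spec_Ucxy.
split; last exact: (spec_unique _ _ _ _ hU).
move=> [a b] [[/= Ua ->]|[/= -> bd]].
  exists (fun f => f 0%N a); split; first exact: in_Spec_horizontal.
  by rewrite /sx /sy mem_set.
exists (vertical_value b); split; first exact: in_Spec_vertical.
(* As monomials, [sx] and [sy] have vertical values 0 b^0 and 1 b^1. *)
rewrite -[sx Ux]/(mono Ux 0 (fun z => z)) -[sy Ux]/(mono Ux 1 (fun _ => 1)).
rewrite (vertical_mono _ _ _ _ hU _ _ _ bd (@holomorphic_id _ Ux)).
rewrite (vertical_mono _ _ _ _ hU _ _ _ bd (@holomorphic_cst _ Ux 1)).
by rewrite mul0r mul1r expr1.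
Qed.
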